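(* Let $p$ be a prime and let $N>1$ be an integer prime to $p$. Then for every integer $r\neq 1$, \[ \sum_{k=1}^{N-1}\widetilde{\psi}^{(r-1)}_p(k/N)=(N-N^r)\,L_p(r,\omega^{1-r}), \] and \[ \sum_{k=1}^{N-1}\widetilde{\psi}^{(0)}_p(k/N)=-N\,p^{-1}\log(N^{p-1}). \]
   Context: For an integer $r$, $\widetilde{\psi}_p^{(r)}(z):=\lim_{n\in\mathbb{Z}_{>0},\,n\to z}\sum_{0<k<n,\ p\nmid k}k^{-(r+1)}$ for $z\in\mathbb{Z}_p$ (the $p$-adic polygamma function; the limit is $p$-adic). $\omega$ denotes the Teichmüller character, $L_p(s,\chi)$ denotes the Kubota–Leopoldt $p$-adic $L$-function of a Dirichlet character $\chi$, and $\log:1+p\mathbb{Z}_p\to p\mathbb{Z}_p$ is the $p$-adic (Iwasawa) logarithm; note $N^{p-1}\in 1+p\mathbb{Z}_p$. *)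

(* Defs.v *)
From HB Require Import structures.
From mathcomp Require Import all_boot all_order all_algebra.
From mathcomp Require Import generic_quotient.
From mathcomp Require Import mathcomp_extra boolp classical_sets functions.
From mathcomp Require Import filter topology.

Set Implicit Arguments.
Unset Strict Implicit.
Unset Printing Implicit Defensive.

Import Order.TTheory GRing.Theory Num.Theory.
Local Open Scope classical_set_scope.
Local Open Scope ring_scope.

(* The ring of p-adic integers as the inverse limit of the rings Z/p^n: the
   n-th component of x is the representative of x mod p^n in [0, p^n[. *)
Record padic_int (p : nat) (p_pr : prime p) := PadicInt {
  residue :> nat -> int;
  residueP : forall n, residue n = (residue n.+1 %% (p ^ n)%N)%Z }.

HB.instance Definition _ p p_pr := gen_eqMixin (@padic_int p p_pr).
HB.instance Definition _ p p_pr := gen_choiceMixin (@padic_int p p_pr).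

Section PadicInt.
Variables (p : nat) (p_pr : prime p).
Local Notation Zp := (padic_int p_pr).
Local Notation "m = n %[pmod k ]" :=
  (modz m (Posz (expn p k)) = modz n (Posz (expn p k)))
  (at level 70, n at next level).
Implicit Types (x y z : Zp) (n m : nat).

Lemma padic_int_ext x y : (forall n, x n = y n) -> x = y.
Proof.
case: x y => [f fP] [g gP] /= /funext fg; rewrite fg in fP *.
by congr PadicInt; exact: Prop_irrelevance.
Qed.

Lemma modz_modp (a : int) m n : (m <= n)%N ->
  ((a %% (p ^ n)%N)%Z = a %[pmod m]).
Proof.
move=> mn; rewrite {2}(divz_eq a (p ^ n)%N).
by rewrite -(subnK mn) expnD PoszM mulrA modzMDl.
Qed.

Lemma residue_le x m n : (m <= n)%N -> x m = (x n %% (p ^ m)%N)%Z.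
Proof.
elim: n => [|n IHn].
  by rewrite leqn0 => /eqP->; rewrite (residueP x) modz_mod.
rewrite leq_eqVlt => /predU1P[->|/[!ltnS] mn].
  by rewrite [LHS]residueP [in RHS]residueP modz_mod.
by rewrite (IHn mn) (residueP x n) modz_modp.
Qed.

Lemma residue_id x n : (x n %% (p ^ n)%N)%Z = x n.
Proof. by rewrite -residue_le. Qed.

Section OfInts.
Variables (f : nat -> int) (fP : forall n, f n.+1 = f n %[pmod n]).
Fact of_ints_subproof n :
  (f n %% (p ^ n)%N)%Z = ((f n.+1 %% (p ^ n.+1)%N)%Z %% (p ^ n)%N)%Z.
Proof. by rewrite modz_modp // fP. Qed.
Definition padic_of_ints : Zp := PadicInt p_pr of_ints_subproof.
End OfInts.

Fact padic_cst_subproof (a : int) n : a = a %[pmod n]. Proof. by []. Qed.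
Definition padic_zero : Zp := padic_of_ints (padic_cst_subproof 0).
Definition padic_one : Zp := padic_of_ints (padic_cst_subproof 1).

Fact padic_opp_subproof x n : - x n.+1 = - x n %[pmod n].
Proof. by rewrite (residueP x n) modzNm. Qed.
Definition padic_opp x : Zp := padic_of_ints (padic_opp_subproof x).

Fact padic_add_subproof x y n : x n.+1 + y n.+1 = x n + y n %[pmod n].
Proof. by rewrite (residueP x n) (residueP y n) modzDm. Qed.
Definition padic_add x y : Zp := padic_of_ints (padic_add_subproof x y).

Fact padic_mul_subproof x y n : x n.+1 * y n.+1 = x n * y n %[pmod n].
Proof. by rewrite (residueP x n) (residueP y n) modzMm. Qed.
Definition padic_mul x y : Zp := padic_of_ints (padic_mul_subproof x y).

Fact padic_addA : associative padic_add.
Proof.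
by move=> x y z; apply: padic_int_ext => n /=; rewrite modzDmr modzDml addrA.
Qed.
Fact padic_addC : commutative padic_add.
Proof. by move=> x y; apply: padic_int_ext => n /=; rewrite addrC. Qed.
Fact padic_add0 : left_id padic_zero padic_add.
Proof.
by move=> x; apply: padic_int_ext => n /=; rewrite modzDml add0r residue_id.
Qed.
Fact padic_addN : left_inverse padic_zero padic_opp padic_add.
Proof.
by move=> x; apply: padic_int_ext => n /=; rewrite modzDml addNr.
Qed.
HB.instance Definition _ :=
  GRing.isZmodule.Build Zp padic_addA padic_addC padic_add0 padic_addN.

Fact padic_mulA : associative padic_mul.
Proof.
by move=> x y z; apply: padic_int_ext => n /=; rewrite modzMmr modzMml mulrA.
Qed.
Fact padic_mulC : commutative padic_mul.
Proof. by move=> x y; apply: padic_int_ext => n /=; rewrite mulrC. Qed.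
Fact padic_mul1 : left_id padic_one padic_mul.
Proof.
by move=> x; apply: padic_int_ext => n /=; rewrite modzMml mul1r residue_id.
Qed.
Fact padic_mulD : left_distributive padic_mul padic_add.
Proof.
move=> x y z; apply: padic_int_ext => n /=.
by rewrite modzMml modzDm mulrDl.
Qed.
Fact padic_one_neq0 : padic_one != padic_zero.
Proof.
apply/eqP => /(congr1 (fun x : Zp => x 1%N)) /=.
by rewrite mod0z modz_small //= expn1 ltz_nat prime_gt1.
Qed.
HB.instance Definition _ := GRing.Zmodule_isComNzRing.Build Zp
  padic_mulA padic_mulC padic_mul1 padic_mulD padic_one_neq0.

Lemma residueD x y n : (x + y) n = ((x n + y n) %% (p ^ n)%N)%Z.
Proof. by []. Qed.
Lemma residueN x n : (- x) n = ((- x n) %% (p ^ n)%N)%Z. Proof. by []. Qed.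
Lemma residueM x y n : (x * y) n = ((x n * y n) %% (p ^ n)%N)%Z.
Proof. by []. Qed.
Lemma residue0 n : (0 : Zp) n = 0. Proof. by rewrite /= mod0z. Qed.

(* The largest v such that p ^ v divides x, when x != 0. *)
Definition padic_ord x : nat := xget 0%N [set v | x v = 0 /\ x v.+1 != 0].

Lemma residue_eq0 x m n : (m <= n)%N -> (x m == 0) = ((p ^ m)%N %| x n)%Z.
Proof. by move=> mn; rewrite (residue_le x mn); apply/eqP/dvdz_mod0P. Qed.

Lemma padic_ordP x : x != 0 -> x (padic_ord x) = 0 /\ x (padic_ord x).+1 != 0.
Proof.
move=> x0; rewrite /padic_ord; case: xgetP => [v _ []//|nov].
case/negP: x0; apply/eqP/padic_int_ext => n; rewrite residue0.
elim: n => [|n IHn]; first by rewrite -(residue_id x 0) expn0 modz1.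
by apply/eqP; case: eqVneq => // xn; case: (nov n).
Qed.

Lemma padic_ordE x v : x v = 0 -> x v.+1 != 0 -> padic_ord x = v.
Proof.
move=> xv xSv; rewrite /padic_ord; apply: xget_unique => // w [xw xSw].
apply/eqP; rewrite eqn_leq; apply/andP; split; rewrite leqNgt; apply/negP.
  by move=> /(residue_le x); rewrite xw mod0z => /eqP; apply/negP.
by move=> /(residue_le x); rewrite xv mod0z => /eqP; apply/negP.
Qed.

Lemma residue_prod x y v w : x v = 0 -> x v.+1 != 0 -> y w = 0 -> y w.+1 != 0 ->
  (x * y) (v + w)%N = 0 /\ (x * y) (v + w).+1 != 0.
Proof.
set n := (v + w).+1; have vn : (v < n)%N by rewrite ltnS leq_addr.
have wn : (w < n)%N by rewrite ltnS leq_addl.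
have p0 k : ((p ^ k)%N : int) != 0 by rewrite eqz_nat -lt0n expn_gt0 prime_gt0.
move=> /eqP; rewrite (residue_eq0 _ (ltnW vn)) => /dvdzP[a xE].
rewrite (residue_eq0 _ vn) xE expnS PoszM dvdz_mul2r ?p0// => pa.
move=> /eqP; rewrite (residue_eq0 _ (ltnW wn)) => /dvdzP[b yE].
rewrite (residue_eq0 _ wn) yE expnS PoszM dvdz_mul2r ?p0// => pb.
have xyE : x n * y n = a * b * (p ^ (v + w))%N.
  by rewrite xE yE expnD PoszM mulrACA.
split.
  by rewrite (residue_le _ (leqnSn _)) residueM modz_modp// xyE modzMl.
rewrite residueM xyE; apply/eqP => /dvdz_mod0P.
rewrite expnS PoszM dvdz_mul2r ?p0// dvdzE abszM Euclid_dvdM//.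
by rewrite -!dvdzE (negPf pa) (negPf pb).
Qed.

Fact padic_int_idomain x y : x * y = 0 -> (x == 0) || (y == 0).
Proof.
move=> xy0; apply/norP => -[/padic_ordP[xv xSv] /padic_ordP[yw ySw]].
by have [_] := residue_prod xv xSv yw ySw; rewrite xy0 residue0.
Qed.

Definition padic_int_unit : pred Zp := fun x => `[< exists y, y * x = 1 >].
Definition padic_int_inv x : Zp :=
  if `[< exists y, y * x = 1 >] then xget 0 [set y | y * x = 1] else x.

Fact padic_int_mulVr : {in padic_int_unit, left_inverse 1 padic_int_inv *%R}.
Proof.
move=> x; rewrite unfold_in /padic_int_inv => ux; rewrite ux.
by move/asboolP: ux => ux; exact: (xgetPex 0 ux).
Qed.
Fact padic_int_unitP x y : y * x = 1 -> padic_int_unit x.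
Proof. by move=> yx; apply/asboolP; exists y. Qed.
Fact padic_int_inv_out : {in [predC padic_int_unit], padic_int_inv =1 id}.
Proof.
by move=> x; rewrite inE /= unfold_in /padic_int_inv => /negPf->.
Qed.
HB.instance Definition _ := GRing.ComNzRing_hasMulInverse.Build Zp
  padic_int_mulVr padic_int_unitP padic_int_inv_out.
HB.instance Definition _ :=
  GRing.ComUnitRing_isIntegral.Build Zp padic_int_idomain.

Definition padic_int_norm x : rat := if x == 0 then 0 else p%:R ^- padic_ord x.
Local Notation "`| x |_p" := (padic_int_norm x) (at level 0, x at level 99).

Let p_gt0 : (0 : rat) < p%:R. Proof. by rewrite ltr0n prime_gt0. Qed.

Lemma padic_int_norm0 : `|0|_p = 0. Proof. by rewrite /padic_int_norm eqxx. Qed.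

Lemma padic_int_norm_gt0 x : (0 < `|x|_p) = (x != 0).
Proof.
by rewrite /padic_int_norm; case: eqVneq; rewrite ?ltxx // invr_gt0 exprn_gt0.
Qed.

Lemma padic_int_norm_eq0 x : (`|x|_p == 0) = (x == 0).
Proof.
by have := padic_int_norm_gt0 x; rewrite /padic_int_norm; case: eqVneq => // _ /gt_eqF.
Qed.

Lemma padic_int_norm_ge0 x : 0 <= `|x|_p.
Proof.
rewrite /padic_int_norm; case: eqVneq => // _.
by rewrite invr_ge0 exprn_ge0 // ltW.
Qed.

Lemma padic_int_normM x y : `|x * y|_p = `|x|_p * `|y|_p.
Proof.
rewrite /padic_int_norm mulf_eq0.
case: eqVneq => [|/padic_ordP[xv xSv]]; first by rewrite mul0r.
case: eqVneq => [|/padic_ordP[yw ySw]] /=; first by rewrite mulr0.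
have [xy xyS] := residue_prod xv xSv yw ySw.
by rewrite (padic_ordE xy xyS) exprD invfM.
Qed.

Lemma padic_int_norm_le x n : (`|x|_p <= p%:R ^- n) = (x n == 0).
Proof.
rewrite /padic_int_norm; case: eqVneq => [->|/padic_ordP[xv xSv]].
  by rewrite residue0 eqxx invr_ge0 exprn_ge0 // ltW.
rewrite lef_pV2 ?posrE ?exprn_gt0 // ler_eXn2l ?ltr1n ?prime_gt1 //.
case: leqP => nv; first by rewrite (residue_le x nv) xv mod0z eqxx.
apply/esym/negP => /eqP xn; case/negP: xSv.
by rewrite (residue_le x nv) xn mod0z.
Qed.

Lemma padic_int_normD x y : `|x + y|_p <= Num.max `|x|_p `|y|_p.
Proof.
have [->|x0] := eqVneq x 0.
  by rewrite add0r le_max lexx orbT.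
have [->|y0] := eqVneq y 0; first by rewrite addr0 le_max lexx.
wlog xy : x y x0 y0 / `|x|_p <= `|y|_p.
  move=> h; case: (leP `|x|_p `|y|_p) => xy; first by rewrite -[leRHS](max_idPr xy) h.
  by rewrite addrC -[leRHS](max_idPl (ltW xy)) maxC h // ltW.
rewrite (max_idPr xy) {2}/padic_int_norm (negPf y0) padic_int_norm_le.
have yo := (padic_ordP y0).1.
move: xy; rewrite {2}/padic_int_norm (negPf y0) padic_int_norm_le => /eqP xo.
by rewrite residueD xo yo addr0 mod0z.
Qed.

Lemma padic_int_normN x : `|- x|_p = `|x|_p.
Proof.
have N1 : `|-1|_p = 1.
  have: `|-1|_p * `|-1|_p = 1.
    rewrite -padic_int_normM mulrNN mulr1 /padic_int_norm oner_eq0.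
    rewrite (@padic_ordE 1 0) ?invr1 //.
    by rewrite /= modz_small ?expn1 //= ltz_nat prime_gt1.
  move/eqP; rewrite -expr2 sqrf_eq1 => /orP[/eqP//|/eqP N1].
  by have := padic_int_norm_ge0 (-1); rewrite N1.
by rewrite -mulN1r padic_int_normM N1 mul1r.
Qed.
End PadicInt.

Definition padic (p : nat) (p_pr : prime p) := {fraction padic_int p_pr}.
HB.instance Definition _ p p_pr := GRing.Field.on (@padic p p_pr).

Section Padic.
Variables (p : nat) (p_pr : prime p).
Local Notation Zp := (padic_int p_pr).
Local Notation Qp := (padic p_pr).
Local Notation "a %:F" := (@FracField.tofrac Zp a : Qp).
Implicit Types (a b : Zp) (x y z : Qp).

(* The normalized absolute value: |p| = 1/p. *)
Definition padic_norm x : rat :=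
  padic_int_norm (frac (repr x)).1 / padic_int_norm (frac (repr x)).2.

Lemma padic_fracP x : exists2 b, b != 0 &
  exists2 a, x = a%:F / b%:F & padic_norm x = padic_int_norm a / padic_int_norm b.
Proof.
exists (frac (repr x)).2; first exact: denom_ratioP.
exists (frac (repr x)).1 => //.
have d0 : (frac (repr x)).2%:F != 0 by rewrite tofrac_eq0 denom_ratioP.
apply: (mulIf d0); rewrite divfK // -{1}(reprK x); unlock FracField.tofrac.
rewrite -[LHS]FracField.pi_mul /FracField.mulf /=; apply/eqmodP => /=.
by rewrite FracField.equivfE !numden_Ratio ?oner_eq0 ?mulr1 ?denom_ratioP // mulrC.
Qed.

Lemma padic_normE a b : b != 0 ->
  padic_norm (a%:F / b%:F) = padic_int_norm a / padic_int_norm b.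
Proof.
move=> b0; have [d d0 [c /eqP]] := padic_fracP (a%:F / b%:F).
rewrite eqr_div ?tofrac_eq0 // -!tofracM tofrac_eq => /eqP ad ->.
apply/eqP; rewrite eqr_div ?padic_int_norm_eq0 //.
by rewrite -!padic_int_normM ad.
Qed.

Lemma padic_norm0 : padic_norm 0 = 0.
Proof.
by rewrite -(mul0r (1%:F)^-1) -tofrac0 padic_normE ?oner_eq0 // padic_int_norm0 mul0r.
Qed.

Lemma padic_norm_eq0 x : (padic_norm x == 0) = (x == 0).
Proof.
have [b b0 [a -> ->]] := padic_fracP x.
by rewrite !mulf_eq0 !invr_eq0 !tofrac_eq0 !padic_int_norm_eq0.
Qed.

Lemma padic_normN x : padic_norm (- x) = padic_norm x.
Proof.
have [b b0 [a -> ->]] := padic_fracP x.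
by rewrite -mulNr -tofracN padic_normE // padic_int_normN.
Qed.

Lemma padic_normM x y : padic_norm (x * y) = padic_norm x * padic_norm y.
Proof.
have [b b0 [a -> ->]] := padic_fracP x; have [d d0 [c -> ->]] := padic_fracP y.
by rewrite mulf_div -!tofracM padic_normE ?mulf_neq0 // !padic_int_normM mulf_div.
Qed.

Lemma padic_normD x y : padic_norm (x + y) <= Num.max (padic_norm x) (padic_norm y).
Proof.
have [b b0 [a -> ->]] := padic_fracP x; have [d d0 [c -> ->]] := padic_fracP y.
rewrite addf_div ?tofrac_eq0 // -!tofracM -tofracD padic_normE ?mulf_neq0 //.
have nb : 0 < padic_int_norm b by rewrite padic_int_norm_gt0.
have nd : 0 < padic_int_norm d by rewrite padic_int_norm_gt0.
rewrite ler_pdivrMr ?padic_int_norm_gt0 ?mulf_neq0 //.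
rewrite maxr_pMl ?padic_int_norm_ge0 //.
rewrite [padic_int_norm (b * d)]padic_int_normM mulrA divfK ?gt_eqF //.
rewrite [X in Num.max _ (_ * X)]mulrC [X in Num.max _ X]mulrA divfK ?gt_eqF //.
by rewrite -!padic_int_normM padic_int_normD.
Qed.

Lemma padic_norm_ge0 x : 0 <= padic_norm x.
Proof. by rewrite /padic_norm divr_ge0 ?padic_int_norm_ge0. Qed.

Definition padic_dist x y : rat := padic_norm (y - x).

Fact padic_distxx x : padic_dist x x = 0.
Proof. by rewrite /padic_dist subrr padic_norm0. Qed.
Fact padic_dist_eq0 x y : padic_dist x y = 0 -> x = y.
Proof. by move/eqP; rewrite padic_norm_eq0 subr_eq0 => /eqP. Qed.
Fact padic_dist_sym x y : padic_dist x y = padic_dist y x.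
Proof. by rewrite /padic_dist -padic_normN opprB. Qed.
Fact padic_dist_triangle y x z :
  padic_dist x z <= padic_dist x y + padic_dist y z.
Proof.
rewrite /padic_dist -[z in leLHS](subrK y) -addrA (le_trans (padic_normD _ _)) //.
by rewrite ge_max lerDl lerDr !padic_norm_ge0.
Qed.
HB.instance Definition _ := isMetric.Build rat Qp
  padic_distxx padic_dist_eq0 padic_dist_sym padic_dist_triangle.
HB.instance Definition _ := isPointed.Build Qp 0.
End Padic.

(* B_m = ([m = 0] - \sum_(k < m) 'C(m + 1, k) B_k) / (m + 1), so B_1 = -1/2;
   bernoulli_seq n lists B_0, ..., B_(n-1). *)
Fixpoint bernoulli_seq (n : nat) : seq rat :=
  if n is m.+1 then
    let s := bernoulli_seq m in
    rcons s (((m == 0%N)%:R - \sum_(k < m) 'C(m.+1, k)%:R * s`_k) / m.+1%:R)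
  else [::].
Definition bernoulli (n : nat) : rat := (bernoulli_seq n.+1)`_n.
Definition bernoulli_poly (n : nat) : {poly rat} :=
  \sum_(k < n.+1) ('C(n, k)%:R * bernoulli k) *: 'X^(n - k).

(* A Dirichlet character modulo m is represented by its modulus and the
   m-periodic function chi : nat -> K vanishing exactly at the integers that
   are not coprime to m. *)
Section DirichletCharacter.
Variable K : fieldType.
Implicit Types (m n : nat) (chi : nat -> K).

Definition conductor m chi : nat :=
  head m [seq d <- divisors m | [forall a : 'I_m,
    coprime a m && (a == 1 %[mod d])%N ==> (chi a == 1)]].

(* The primitive character inducing chi; its modulus is conductor m chi. When
   a is not coprime to the conductor, no b is picked and the value is 0. *)
Definition primitive_char m chi (a : nat) : K :=
  if [pick b : 'I_m | coprime b m && (b == a %[mod conductor m chi])%N] is Some b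
  then chi b else 0.

(* The generalized Bernoulli number B_(n, chi) of a character modulo f. *)
Definition gen_bernoulli f chi n : K :=
  f%:R ^ (n%:Z - 1) *
  \sum_(1 <= a < f.+1)
    chi a * (map_poly ratr (bernoulli_poly n)).[a%:R / f%:R].
End DirichletCharacter.

(* The conductor q of the Teichmuller character: p if p is odd, 4 if p = 2. *)
Definition teichmuller_modulus (p : nat) : nat := if p == 2%N then 4 else p.

Section PadicFunctions.
Variables (p : nat) (p_pr : prime p).
Local Notation Qp := (padic p_pr).
Local Notation q := (teichmuller_modulus p).

(* The filter of positive integers tending to z in the p-adic topology. It is
   proper exactly when z is in the closure Z_p of the positive integers. *)
Definition posnat_near (z : Qp) : set_system nat :=
  filter_from (nbhs z) (fun B => [set n : nat | (0 < n)%N /\ B n%:R]).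

Definition padic_polygamma (r : int) (z : Qp) : Qp :=
  lim ((fun n : nat => \sum_(1 <= k < n | ~~ (p %| k)%N) k%:R ^ (- (r + 1)) : Qp)
       @ posnat_near z).

Definition padic_log (x : Qp) : Qp :=
  limn (fun n : nat => \sum_(1 <= k < n) (-1) ^+ k.+1 * (x - 1) ^+ k / k%:R : Qp).

(* The root of unity of order dividing phi(q) congruent to a modulo q. *)
Definition teichmuller (a : nat) : Qp :=
  xget 0 [set w | w ^+ totient q = 1 /\ padic_norm (w - a%:R) <= q%:R^-1].

(* The power omega ^ i, as a character modulo q. *)
Definition teichmuller_pow (i : int) (a : nat) : Qp :=
  if (p %| a)%N then 0 else teichmuller a ^ i.

(* The value at 1 - n, for n > 0, of the Kubota-Leopoldt L-function of a
   character chi modulo m, namely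
     - (1 - psi(p) p^(n-1)) B_(n, psi) / n
   where psi is the primitive character associated with chi * omega ^ (- n). *)
Definition padic_L_value (m : nat) (chi : nat -> Qp) (n : nat) : Qp :=
  let M := lcmn m q in
  let chin a := chi a * teichmuller_pow (- n%:Z) a in
  let psi := primitive_char M chin in
  - (1 - psi p * p%:R ^ (n%:Z - 1)) *
    gen_bernoulli (conductor M chin) psi n / n%:R.

(* L_p(s, chi) for s in Z_p is the extension by continuity of its values at the
   integers 1 - n with n > 0, which are dense in Z_p. The limit is taken over
   all n > 0 tending to 1 - s (n = 1 - s included, when it occurs) with no
   congruence condition modulo p - 1; it exists for every s in Z_p, except for
   the pole s = 1 when chi is trivial. *)
Definition padic_L (m : nat) (chi : nat -> Qp) (s : Qp) : Qp :=
  lim (padic_L_value m chi @ posnat_near (1 - s)).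

End PadicFunctions.

(* Main.v *)
Require Import Defs.
From HB Require Import structures.
From mathcomp Require Import all_boot all_order all_algebra.
From mathcomp Require Import cyclic ring lra zify.
From mathcomp Require Import boolp classical_sets filter topology.

Set Implicit Arguments.
Unset Strict Implicit.
Unset Printing Implicit Defensive.

Import Order.TTheory GRing.Theory Num.Theory.
Local Open Scope ring_scope.

(* Let P = p^m, c_a = floor (N a / P), and let Psi be the sum of the polygamma
   values at k/N. Counting gives sum_(a < P, p not dividing a) c_a a^(-r) -> -Psi
   as m tends to infinity. Reindexing T = sum_(a < P) chi(a) a^n, with
   chi = omega^(1-r-n), by a |-> N a - P c_a and expanding modulo P^2 yields
     (1 - chi(N) N^n) T + n P chi(N) N^(n-1) sum_a c_a chi(a) a^(n-1) = O(P^2).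
   After division by P, the first term involves T / P -> - n L_p(1-n, omega^(1-r)),
   and chi(a) a^(n-1) is close to a^(-r), uniformly in a, when n is close to 1 - r.
   So (1 - N^(1-r)) L_p(r, omega^(1-r)) = - N^(-r) Psi; as N^(1-r) <> 1 for r <> 1,
   this also gives the existence of the limit defining L_p.
   For r = 1 one reindexes the product of the a < P prime to p instead: it gives
   N^(-phi(P)) = 1 - (P / N) sum_a c_a / a + O(P^2), while
   (Y^(p^m) - 1) / p^m -> log Y for Y = N^(p-1). *)

(** * The p-adic absolute value *)

(** The order of the two limits matters. For fixed n, m tends to infinity first: the error modulo
    P^2 disappears, and what remains is a bound by |n| p^(-M) on n times the wanted combination, so
    that n can be cancelled even when p divides it. Only then does n tend to 1 - r. No congruence on
    n modulo p - 1 is needed because chi(a) a^(n-1) = a^(-r) (a / omega(a))^(n-1+r), where a /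
    omega(a) lies in 1 + pZ_p and its powers are p-adically continuous in the exponent. For the same
    reason chi(N) N^n tends to N^(1-r). *)

Section PadicNorm.
Variables (p : nat) (p_pr : prime p).
Local Notation Zp := (padic_int p_pr).
Local Notation Qp := (padic p_pr).
Local Notation "`| x |_p" := (@padic_norm p p_pr x) (at level 0, x at level 99).
Implicit Types (x y z : Qp) (e f : rat).

Lemma padic_norm1 : `|1|_p = 1.
Proof.
have: `|1 * 1|_p == `|1|_p by rewrite mulr1.
rewrite padic_normM -subr_eq0 -{3}[`|1|_p]mulr1 -mulrBr mulf_eq0.
by rewrite padic_norm_eq0 oner_eq0 subr_eq0 => /eqP.
Qed.

Lemma padic_normX x n : `|x ^+ n|_p = `|x|_p ^+ n.
Proof.
by elim: n => [|n IHn]; rewrite ?expr0 ?padic_norm1 // !exprS padic_normM IHn.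
Qed.

Lemma padic_normV x : `|x^-1|_p = `|x|_p^-1.
Proof.
have [->|x0] := eqVneq x 0; first by rewrite invr0 padic_norm0 invr0.
have nx0 : `|x|_p != 0 by rewrite padic_norm_eq0.
by apply: (mulfI nx0); rewrite -padic_normM !divff // padic_norm1.
Qed.

Lemma padic_normXz x (i : int) : `|x ^ i|_p = `|x|_p ^ i.
Proof. by case: i => n; rewrite /exprz ?padic_normV padic_normX. Qed.

Lemma padic_norm_leD x y e : `|x|_p <= e -> `|y|_p <= e -> `|x + y|_p <= e.
Proof. by move=> xe ye; rewrite (le_trans (padic_normD _ _)) // ge_max xe. Qed.

Lemma padic_norm_leB x y e : `|x|_p <= e -> `|y|_p <= e -> `|x - y|_p <= e.
Proof. by move=> xe ye; rewrite padic_norm_leD ?padic_normN. Qed.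

Lemma padic_norm_distC x y : `|x - y|_p = `|y - x|_p.
Proof. by rewrite -padic_normN opprB. Qed.

Lemma padic_dist_trans y x z e :
  `|x - y|_p <= e -> `|y - z|_p <= e -> `|x - z|_p <= e.
Proof. by move=> xy yz; rewrite -(subrKA y) padic_norm_leD. Qed.

Lemma padic_norm_le_sum I (r : seq I) (P : pred I) (F : I -> Qp) e :
  0 <= e -> (forall i, P i -> `|F i|_p <= e) -> `|\sum_(i <- r | P i) F i|_p <= e.
Proof.
move=> e0 Fe; elim/big_ind: _ => //; first by rewrite padic_norm0.
by move=> x y; exact: padic_norm_leD.
Qed.

Lemma padic_norm_leM x y e f : `|x|_p <= e -> `|y|_p <= f -> `|x * y|_p <= e * f.
Proof. by move=> xe yf; rewrite padic_normM ler_pM ?padic_norm_ge0. Qed.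

Lemma padic_norm_leMl x y e : `|x|_p <= 1 -> `|y|_p <= e -> `|x * y|_p <= e.
Proof. by move=> x1 ye; rewrite -[e]mul1r padic_norm_leM. Qed.

Lemma padic_norm_leMr x y e : `|x|_p <= e -> `|y|_p <= 1 -> `|x * y|_p <= e.
Proof. by move=> xe y1; rewrite mulrC padic_norm_leMl. Qed.

Lemma padic_norm_leX x n : `|x|_p <= 1 -> `|x ^+ n|_p <= 1.
Proof. by move=> x1; rewrite padic_normX exprn_ile1 // padic_norm_ge0. Qed.

(** The norm is locally constant away from 0. This gives the continuity of inversion, and later
    keeps denominators away from 0 near a nonzero limit. *)
Lemma padic_norm_eq x y : `|x - y|_p < `|y|_p -> `|x|_p = `|y|_p.
Proof.
move=> xy; apply/eqP; rewrite eq_le; apply/andP; split.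
  by rewrite -[x](subrK y) padic_norm_leD // ltW.
rewrite leNgt; apply/negP => xlty.
have: `|y|_p <= Num.max `|x|_p `|x - y|_p.
  by rewrite -[y](subKr x) (le_trans (padic_normD _ _)) // padic_normN subKr.
by rewrite le_max !leNgt xlty xy.
Qed.

Lemma padic_norm_tofrac (a : Zp) : `|FracField.tofrac a : Qp|_p = padic_int_norm a.
Proof.
rewrite -[X in padic_norm X]divr1 -tofrac1 padic_normE ?oner_eq0 //.
suff -> : padic_int_norm (1 : Zp) = 1 by rewrite divr1.
have n0 : padic_int_norm (1 : Zp) != 0 by rewrite padic_int_norm_eq0 oner_eq0.
by apply: (mulfI n0); rewrite -padic_int_normM !mulr1.
Qed.

Lemma residue_nat n m : (n%:R : Zp) m = (n %% p ^ m)%N.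
Proof.
elim: n => [|n IHn]; first by rewrite residue0 mod0n.
rewrite mulrS residueD IHn (_ : (1 : Zp) m = (1 %% (p ^ m)%N)%Z) //.
by rewrite modzDml -modz_nat modzDmr -PoszD modz_nat add1n.
Qed.

Lemma padic_norm_nat_le n m : (`|n%:R : Qp|_p <= p%:R ^- m) = (p ^ m %| n)%N.
Proof.
rewrite -[n%:R](rmorph_nat (@FracField.tofrac Zp)) padic_norm_tofrac.
by rewrite padic_int_norm_le residue_nat.
Qed.


Lemma padic_norm_nat_le1 n : `|n%:R : Qp|_p <= 1.
Proof. by have := padic_norm_nat_le n 0; rewrite expr0 invr1 expn0 dvd1n. Qed.

Lemma padic_norm_int_le1 (i : int) : `|i%:~R : Qp|_p <= 1.
Proof.
by case: i => n; rewrite ?NegzE ?mulrNz ?padic_normN padic_norm_nat_le1.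
Qed.

Lemma padic_norm_int_le (i : int) m :
  (`|i%:~R : Qp|_p <= p%:R ^- m) = (p ^ m %| absz i)%N.
Proof.
by case: i => n; rewrite ?NegzE ?mulrNz ?padic_normN padic_norm_nat_le ?abszN.
Qed.

Lemma padic_norm_natB_le a b m :
  (`|(a%:R - b%:R : Qp)|_p <= p%:R ^- m) = (a == b %[mod p ^ m])%N.
Proof.
wlog ab : a b / (b <= a)%N => [h|].
  case/orP: (leq_total b a) => ab; first exact: h.
  by rewrite padic_norm_distC h // eq_sym.
by rewrite -natrB // padic_norm_nat_le eqn_mod_dvd.
Qed.

Lemma padic_norm_p : `|p%:R : Qp|_p = p%:R^-1.
Proof.
rewrite -[p%:R](rmorph_nat (@FracField.tofrac Zp)) padic_norm_tofrac.
have p1 := prime_gt1 p_pr; have p0 : (0 < p)%N := prime_gt0 p_pr.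
rewrite /padic_int_norm (@padic_ordE _ _ _ 1) ?residue_nat ?expn1 ?modnn //.
  by case: eqVneq => // /(congr1 (fun x : Zp => x 2)); rewrite residue_nat
     residue0 modn_small ?ltn_Pmulr // => -[p00]; rewrite p00 in p0.
by rewrite modn_small ?ltn_Pmulr // eqz_nat -lt0n.
Qed.

(** If a positive n vanished in Q_p, then p^n would divide n, although n < p^n. *)
Lemma natr_padic_eq0 n : (n%:R == 0 :> Qp) = (n == 0)%N.
Proof.
apply/idP/idP => [/eqP n0|/eqP->]; last by rewrite eqxx.
have := padic_norm_nat_le n n.
rewrite n0 padic_norm0 invr_ge0 exprn_ge0 ?ler0n // => /esym /dvdn_leq.
case: (posnP n) => [->//|n_gt0 /(_ isT)].
by rewrite leqNgt ltn_expl ?prime_gt1.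
Qed.

End PadicNorm.

(** * Density of the positive integers in Z_p, and completeness *)

Section PadicLimits.
Variables (p : nat) (p_pr : prime p).
Local Notation Zp := (padic_int p_pr).
Local Notation Qp := (padic p_pr).
Local Notation "`| x |_p" := (@padic_norm p p_pr x) (at level 0, x at level 99).
Implicit Types (x y z : Qp) (e f : rat).

Lemma residue_int (i : int) m : (i%:~R : Zp) m = (i %% (p ^ m)%N)%Z.
Proof.
case: i => n; first by rewrite residue_nat modz_nat.
by rewrite NegzE mulrNz residueN residue_nat -modz_nat modzNm.
Qed.

Lemma expVp_ge0 m : 0 <= p%:R ^- m :> rat.
Proof. by rewrite invr_ge0 exprn_ge0. Qed.

Lemma expVp_gt0 m : 0 < p%:R ^- m :> rat.
Proof. by rewrite invr_gt0 exprn_gt0 // ltr0n prime_gt0. Qed.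

Lemma expVp_le1 m : p%:R ^- m <= 1 :> rat.
Proof. by rewrite invf_le1 ?exprn_gt0 ?exprn_ege1 ?ltr0n ?ler1n ?prime_gt0. Qed.

Lemma expVp_le m n : (n <= m)%N -> p%:R ^- m <= p%:R ^- n :> rat.
Proof.
by move=> nm; rewrite lef_pV2 ?posrE ?exprn_gt0 ?ler_weXn2l ?ltr0n ?ler1n ?prime_gt0.
Qed.

Lemma expVp_small e : 0 < e -> exists m, p%:R ^- m <= e.
Proof.
move=> e0; exists (Num.bound e^-1).
rewrite invf_ple ?posrE ?exprn_gt0 ?ltr0n ?prime_gt0 //.
rewrite ltW // (lt_trans (archi_boundP _)) ?invr_ge0 1?ltW //.
by rewrite -natrX ltr_nat ltn_expl ?prime_gt1.
Qed.

Lemma dvdz_mod_expn k n (i : int) : (k <= n)%N ->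
  ((p ^ k)%N %| (i %% (p ^ n)%N))%Z = ((p ^ k)%N %| i)%Z.
Proof.
by move=> kn; apply/idP/idP => /dvdz_mod0P H; apply/dvdz_mod0P;
  move: H; rewrite modz_modp.
Qed.

Lemma padic_approx x m : `|x|_p <= 1 ->
  exists2 n, (0 < n)%N & `|x - n%:R|_p <= p%:R ^- m.
Proof.
have [b b0 [a -> ->]] := padic_fracP x.
have [bv bSv] := padic_ordP b0; set v := padic_ord b in bv bSv.
have nb : padic_int_norm b = p%:R ^- v by rewrite /padic_int_norm (negPf b0).
rewrite ler_pdivrMr ?padic_int_norm_gt0 // mul1r nb padic_int_norm_le => av.
have pv0 k : ((p ^ k)%N : int) != 0 by rewrite eqz_nat -lt0n expn_gt0 prime_gt0.
(* The representatives of a and b modulo p^n replace a and b. The precision v + m determines a / b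
   modulo p^m; the extra digit ensures v < n even when m = 0, which makes the cofactor [B'] prime to
   p. *)
pose n := (v + m).+1.
have vn : (v < n)%N by rewrite ltnS leq_addr.
have mvn : (m + v <= n)%N by rewrite addnC leqW.
move: av; rewrite (residue_eq0 _ (ltnW vn)) => /dvdzP[A' aE].
move/eqP: bv; rewrite (residue_eq0 _ (ltnW vn)) => /dvdzP[B' bE].
move: bSv; rewrite (residue_eq0 _ vn) bE expnS PoszM dvdz_mul2r ?pv0 // => pB.
have /coprimezP[[u w] /= uw] : coprimez B' (p ^ m)%N.
  by rewrite coprimezE coprimeXr // coprime_sym prime_coprime.
(* [u] inverts [B'] modulo p^m, so [c] represents [A'] / [B'], that is x, modulo p^m. *)
pose c : int := u * A'.
have c_approx : `|FracField.tofrac a / FracField.tofrac b - c%:~R : Qp|_p <= p%:R ^- m.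
  have bF0 : FracField.tofrac b != 0 :> Qp by rewrite tofrac_eq0.
  rewrite -[c%:~R](mulfK bF0) -mulrBl -[c%:~R](rmorph_int (@FracField.tofrac Zp)).
  rewrite -tofracM -tofracB padic_normE // nb ler_pdivrMr ?expVp_gt0 //.
  rewrite -invfM -exprD padic_int_norm_le (residue_eq0 _ mvn).
  have -> : (a - c%:~R * b) n = ((a n - c * b n) %% (p ^ n)%N)%Z.
    by rewrite residueD residueN residueM residue_int modzMml modzNm modzDmr.
  rewrite (dvdz_mod_expn _ mvn).
  apply/dvdzP; exists (A' * w); rewrite aE bE expnD PoszM /c.
  move: uw; move: (Posz (p ^ m)%N) (Posz (p ^ v)%N) => P V uw.
  have wP : w * P = 1 - u * B' by rewrite -uw addrC addKr.
  rewrite (_ : A' * w * (P * V) = A' * (w * P) * V); last ring.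
  by rewrite wP; ring.
pose k := absz (c %% (p ^ m)%N)%Z.
(* Adding p^m keeps the residue and makes the integer positive. *)
exists (k + p ^ m)%N; first by rewrite addn_gt0 expn_gt0 (prime_gt0 p_pr) orbT.
apply: padic_dist_trans c_approx _.
have kE : Posz k = (c %% (p ^ m)%N)%Z by rewrite gez0_abs // modz_ge0.
rewrite -[(_ + _)%:R]/((Posz (k + p ^ m)%N)%:~R) -rmorphB /= padic_norm_int_le.
suff: ((p ^ m)%N %| c - Posz (k + p ^ m)%N)%Z by rewrite dvdzE.
rewrite PoszD kE {1}(divz_eq c (p ^ m)%N) opprD addrA addrK rpredB // ?dvdzz //.
by rewrite dvdz_mull.
Qed.

(** Rounding each [u m] to an integer modulo p^m turns the Cauchy condition into compatibility of
    residues, so the limit is a point of the inverse limit that defines Z_p. *)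
Lemma padic_complete (u : nat -> Qp) :
  (forall m, `|u m|_p <= 1) -> (forall m, `|u m.+1 - u m|_p <= p%:R ^- m) ->
  exists l, forall m, `|u m - l|_p <= p%:R ^- m.
Proof.
move=> u1 uS.
have /choice[c cP] m : exists n, `|u m - n%:R|_p <= p%:R ^- m.
  by have [n _ un] := padic_approx m (u1 m); exists n.
have cS m : (Posz (c m.+1) = Posz (c m) %[mod (p ^ m)%N])%Z.
  rewrite !modz_nat; congr Posz; apply/eqP; rewrite -(padic_norm_natB_le p_pr).
  apply: (padic_dist_trans (y := u m.+1)).
    by rewrite padic_norm_distC (le_trans (cP _)) // expVp_le.
  exact: padic_dist_trans (uS m) (cP m).
exists (FracField.tofrac (padic_of_ints p_pr cS)) => m.
apply: padic_dist_trans (cP m) _.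
rewrite -[(c m)%:R](rmorph_nat (@FracField.tofrac Zp)) -tofracB padic_norm_tofrac.
rewrite padic_int_norm_le residueD residueN residue_nat /=.
by rewrite modzDmr -modz_nat subrr mod0z.
Qed.

End PadicLimits.

(** * Limits of p-adic functions *)

Lemma subVr (K : fieldType) (x y : K) : x != 0 -> y != 0 ->
  x^-1 - y^-1 = (y - x) / (x * y).
Proof. by move=> x0 y0; field; rewrite x0 y0. Qed.

Section PadicTends.
Variables (p : nat) (p_pr : prime p).
Local Notation Zp := (padic_int p_pr).
Local Notation Qp := (padic p_pr).
Local Notation "`| x |_p" := (@padic_norm p p_pr x) (at level 0, x at level 99).
Implicit Types (x y z : Qp) (e : rat).

(* Limits are handled through the norm: [padic] is a metric space, but it is not
   declared as a topological ring. *)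
Definition tends (T : Type) (F : set_system T) (f : T -> Qp) (l : Qp) :=
  forall e, 0 < e -> F (fun t => `|f t - l|_p <= e).

Section Filters.
Variables (T : Type) (F : set_system T).
Context {FF : Filter F}.
Implicit Types (f g : T -> Qp) (l k : Qp).

Lemma tends_cvg f l : tends F f l -> (f @ F --> l)%classic.
Proof.
move=> fl; apply/metricType_numDomainType.cvgrPdist_lt => e e0.
have [e2 e20 e2e] : exists2 e', 0 < e' & e' < e by exists (e / 2); lra.
by apply: filterS (fl _ e20) => t; rewrite /mdist /= => /le_lt_trans; apply.
Qed.

Lemma tends_lim {PF : ProperFilter F} f l : tends F f l -> lim (f @ F)%classic = l.
Proof.
by move=> fl; apply: cvg_lim; [exact: metric_hausdorff|exact: tends_cvg].
Qed.

Lemma tends_cst l : tends F (fun=> l) l.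
Proof. by move=> e e0; apply: filterE => t; rewrite subrr padic_norm0 ltW. Qed.

Lemma tends_ext f g l : (forall t, f t = g t) -> tends F f l -> tends F g l.
Proof. by move=> /funext->. Qed.

Lemma tends_eq f l k : tends F f l -> l = k -> tends F f k.
Proof. by move=> + <-. Qed.

Lemma tendsD f g l k :
  tends F f l -> tends F g k -> tends F (fun t => f t + g t) (l + k).
Proof.
move=> fl gk e e0; apply: filterS2 (fl e e0) (gk e e0) => t ft gt.
by rewrite opprD addrACA padic_norm_leD.
Qed.

Lemma tendsM f g l k :
  tends F f l -> tends F g k -> tends F (fun t => f t * g t) (l * k).
Proof.
move=> fl gk e e0.
(* Precision e / M suffices: the terms |l| and |k| control the two linear error terms, and the term
   e gives e / M <= 1, which controls the quadratic one. *)
pose M := 1 + `|l|_p + `|k|_p + e.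
have [nl nk] : 0 <= `|l|_p /\ 0 <= `|k|_p by rewrite !padic_norm_ge0.
have M1 : 1 <= M by rewrite /M; lra.
have M0 : 0 < M by lra.
have eM : e / M <= 1 by rewrite ler_pdivrMr // mul1r /M; lra.
have eM0 : 0 < e / M by rewrite divr_gt0.
have eMe : e / M <= e by rewrite ler_pdivrMr // ler_peMr // ltW.
apply: filterS2 (fl _ eM0) (gk _ eM0) => t ft gt.
rewrite (_ : _ - _ = (f t - l) * (g t - k) + (f t - l) * k + l * (g t - k)); last ring.
apply: padic_norm_leD; first apply: padic_norm_leD.
- rewrite (le_trans (padic_norm_leM ft gt)) //
    (le_trans (ler_piMr (ltW eM0) eM)) //.
- rewrite (le_trans (padic_norm_leM ft (lexx _))) // mulrAC ler_pdivrMr //.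
  by rewrite ler_pM2l // /M; lra.
- rewrite (le_trans (padic_norm_leM (lexx _) gt)) // mulrA ler_pdivrMr //.
  by rewrite mulrC ler_pM2l // /M; lra.
Qed.

Lemma tendsZ f l a : tends F f l -> tends F (fun t => a * f t) (a * l).
Proof. exact/tendsM/tends_cst. Qed.

Lemma tendsN f l : tends F f l -> tends F (fun t => - f t) (- l).
Proof.
move=> /(tendsZ (-1)); rewrite mulN1r; apply: tends_ext => t; exact: mulN1r.
Qed.

Lemma tendsB f g l k :
  tends F f l -> tends F g k -> tends F (fun t => f t - g t) (l - k).
Proof. by move=> fl /tendsN; exact: tendsD. Qed.

Lemma tends_sum I (r : seq I) (P : pred I) (f : I -> T -> Qp) (l : I -> Qp) :
  (forall i, P i -> tends F (f i) (l i)) ->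
  tends F (fun t => \sum_(i <- r | P i) f i t) (\sum_(i <- r | P i) l i).
Proof.
move=> fl; elim: r => [|i r IHr].
  by rewrite big_nil; apply: tends_ext (tends_cst _) => t; rewrite big_nil.
rewrite big_cons; case: ifP => Pi; last first.
  by apply: tends_ext IHr => t; rewrite big_cons Pi.
by apply: tends_ext (tendsD (fl i Pi) IHr) => t; rewrite big_cons Pi.
Qed.

Lemma tendsX f l n : tends F f l -> tends F (fun t => f t ^+ n) (l ^+ n).
Proof.
move=> fl; elim: n => [|n IHn].
  by rewrite expr0; apply: tends_ext (tends_cst _) => t; rewrite expr0.
by rewrite exprS; apply: tends_ext (tendsM fl IHn) => t; rewrite exprS.
Qed.

Lemma tendsV f l : l != 0 -> tends F f l -> tends F (fun t => (f t)^-1) l^-1.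
Proof.
move=> l0 fl e e0; have nl : 0 < `|l|_p.
  by rewrite lt_neqAle padic_norm_ge0 eq_sym padic_norm_eq0 l0.
have nl2 : 0 < `|l|_p / 2 by lra.
have e'0 : 0 < e * `|l|_p ^+ 2 by rewrite mulr_gt0 // exprn_gt0.
apply: filterS2 (fl _ nl2) (fl _ e'0) => t ft ft'.
have nft : `|f t|_p = `|l|_p by apply: padic_norm_eq; lra.
have ft0 : f t != 0 by rewrite -padic_norm_eq0 nft gt_eqF.
rewrite subVr //.
rewrite padic_normM padic_normV padic_normM nft -expr2 padic_norm_distC.
by rewrite ler_pdivrMr // exprn_gt0.
Qed.

Lemma tends_near f g l :
  (forall e, 0 < e -> F (fun t => `|f t - g t|_p <= e)) ->
  tends F g l -> tends F f l.
Proof.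
move=> fg gl e e0; apply: filterS2 (fg e e0) (gl e e0) => t.
exact: padic_dist_trans.
Qed.

Lemma tends_le {PF : ProperFilter F} f l e : 0 < e ->
  tends F f l -> F (fun t => `|f t|_p <= e) -> `|l|_p <= e.
Proof.
move=> e0 fl fe; have [t [ft ft']] := filter_ex (filterI (fl e e0) fe).
by rewrite -[l](subKr (f t)) padic_norm_leB.
Qed.

End Filters.

Lemma tends_ooP (u : nat -> Qp) l : tends \oo%classic u l <->
  forall M, exists n0, forall n, (n0 <= n)%N -> `|u n - l|_p <= p%:R ^- M.
Proof.
split=> [ul M|ul e e0].
  by have [n0 _ n0P] := ul _ (expVp_gt0 p_pr M); exists n0 => n; exact: n0P.
have [M Me] := expVp_small p_pr e0; have [n0 n0P] := ul M.
by exists n0 => // n /= /n0P /le_trans; apply.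
Qed.

Lemma tends_oo_shift (u : nat -> Qp) l k :
  tends \oo%classic (fun n => u (n + k)%N) l -> tends \oo%classic u l.
Proof.
move=> /tends_ooP ul; apply/tends_ooP => M; have [n0 n0P] := ul M.
exists (n0 + k)%N => n n0k; have kn : (k <= n)%N by lia.
by rewrite -(subnK kn) n0P //; lia.
Qed.

Lemma tends_oo_subseq (u : nat -> Qp) l k :
  tends \oo%classic u l -> tends \oo%classic (fun n => u (n + k)%N) l.
Proof.
move=> /tends_ooP ul; apply/tends_ooP => M; have [n0 n0P] := ul M.
by exists n0 => n n0k; apply: n0P; lia.
Qed.

Lemma tends_expp : tends \oo%classic (fun m => p%:R ^+ m) 0.
Proof.
apply/tends_ooP => M; exists M => n Mn.
by rewrite subr0 padic_normX padic_norm_p exprVn expVp_le.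
Qed.

Section PosnatNear.
Variable z : Qp.

Lemma posnat_nearP (A : set nat) : posnat_near z A <->
  exists m, forall n, (0 < n)%N -> `|n%:R - z|_p <= p%:R ^- m -> A n.
Proof.
split=> [[B /nbhs_ballP[e /= e0 eB] BA]|[m mA]].
  have [e2 e20 e2e] : exists2 e', 0 < e' & e' < e by exists (e / 2); lra.
  have [m me] := expVp_small p_pr e20; exists m => n n0 nz.
  apply: BA; split => //; apply: eB; rewrite ballEmdist /=.
  by rewrite (le_lt_trans nz) // (le_lt_trans me).
exists (fun x => `|x - z|_p <= p%:R ^- m); last by move=> n [n0 nz]; exact: mA.
apply/nbhs_ballP; exists (p%:R ^- m); first exact: expVp_gt0.
by move=> x; rewrite ballEmdist /=; exact: ltW.
Qed.

Global Instance posnat_near_filter : Filter (posnat_near z).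
Proof.
apply: filter_from_filter; first by exists setT; exact: filterT.
move=> A B zA zB; exists (A `&` B)%classic; first exact: filterI.
by move=> n [n0 [An Bn]].
Qed.

Lemma posnat_near_proper : `|z|_p <= 1 -> ProperFilter (posnat_near z).
Proof.
move=> z1; apply: Build_ProperFilter_ex => A /posnat_nearP[m mA].
have [n n0 zn] := padic_approx m z1.
by exists n; apply: mA => //; rewrite padic_norm_distC.
Qed.

Lemma tends_posnatP (f : nat -> Qp) l :
  (forall M, exists m, forall n, (0 < n)%N -> `|n%:R - z|_p <= p%:R ^- m ->
    `|f n - l|_p <= p%:R ^- M) -> tends (posnat_near z) f l.
Proof.
move=> fl e e0; have [M Me] := expVp_small p_pr e0; have [m mP] := fl M.
apply/posnat_nearP; exists m => n n0 nz.
exact: le_trans (mP n n0 nz) Me.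
Qed.

End PosnatNear.
End PadicTends.

(** * Sums of Lipschitz functions *)

(** Multiplication by c permutes the residues modulo M. A general commutative law is used because
    both sums and, for r = 1, a product are reindexed. *)
Lemma big_modM (R : Type) (idx : R) (op : Monoid.com_law idx) (c M : nat)
    (f : nat -> R) : (0 < M)%N -> coprime c M ->
  \big[op/idx]_(0 <= a < M) f (c * a %% M)%N = \big[op/idx]_(0 <= a < M) f a.
Proof.
move=> M0 cM; rewrite !big_mkord.
pose h (i : 'I_M) : 'I_M := Ordinal (ltn_pmod (c * i) M0).
have hi : injective h.
  move=> i j /(congr1 (@nat_of_ord M)) /= /eqP ij; apply: val_inj => /=.
  wlog le_ij : i j ij / (i <= j)%N => [hw|].
    by case/orP: (leq_total i j) => le; [|symmetry]; apply: hw => //; rewrite eq_sym.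
  move: ij; rewrite eq_sym eqn_mod_dvd ?leq_mul2l ?le_ij ?orbT // -mulnBr.
  rewrite Gauss_dvdr 1?coprime_sym // => /dvdn_leq.
  by have := ltn_ord j; lia.
by rewrite [RHS](reindex_inj hi).
Qed.

Section LipschitzSums.
Variables (p : nat) (p_pr : prime p).
Local Notation Zp := (padic_int p_pr).
Local Notation Qp := (padic p_pr).
Local Notation "`| x |_p" := (@padic_norm p p_pr x) (at level 0, x at level 99).
Implicit Types (x y z : Qp) (e : rat).

Definition padic_lipschitz (g : nat -> Qp) :=
  (forall a, `|g a|_p <= 1) /\
  forall m a b, (a = b %[mod p ^ m])%N -> `|g a - g b|_p <= p%:R ^- m.

Lemma padic_norm_leXB x y e n : `|x|_p <= 1 -> `|y|_p <= 1 -> `|x - y|_p <= e ->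
  `|x ^+ n - y ^+ n|_p <= e.
Proof.
move=> x1 y1 xy; rewrite subrXX padic_norm_leMr // padic_norm_le_sum // => i _.
by rewrite padic_norm_leMl ?padic_norm_leX.
Qed.

Lemma padic_norm1_neq0 x : `|x|_p = 1 -> x != 0.
Proof. by move=> x1; rewrite -padic_norm_eq0 x1 oner_eq0. Qed.

Lemma padic_norm_leXzB x y e (i : int) : `|x|_p = 1 -> `|y|_p = 1 ->
  `|x - y|_p <= e -> `|x ^ i - y ^ i|_p <= e.
Proof.
move=> x1 y1 xy; case: i => n; first by rewrite padic_norm_leXB ?x1 ?y1.
have [x0 y0] := (padic_norm1_neq0 x1, padic_norm1_neq0 y1).
rewrite NegzE -!exprnN subVr ?expf_neq0 // padic_norm_leMr //.
  by rewrite padic_norm_leXB ?x1 ?y1 // padic_norm_distC.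
by rewrite padic_normV padic_normM !padic_normX x1 y1 !expr1n mul1r invr1.
Qed.

Lemma padic_norm_nat_unit a : ~~ (p %| a)%N -> `|a%:R : Qp|_p = 1.
Proof.
move=> pa; apply/eqP; rewrite eq_le padic_norm_nat_le1 /=.
have /coprimezP[[u w] /= uw] : coprimez a p.
  by rewrite coprimezE /= coprime_sym prime_coprime.
rewrite leNgt; apply/negP => a1.
have := padic_norm1 p_pr; rewrite -[1]/(1%:~R) -uw rmorphD !rmorphM /= => h1.
suff: `|u%:~R * a%:R + w%:~R * p%:R : Qp|_p < 1 by rewrite h1 ltxx.
rewrite (le_lt_trans (padic_normD _ _)) // gt_max !padic_normM padic_norm_p.
have M1 (i : int) f : 0 <= f -> f < 1 -> `|i%:~R : Qp|_p * f < 1.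
  by move=> f0; exact: le_lt_trans (ler_piMl f0 (padic_norm_int_le1 _ _)).
rewrite !M1 ?padic_norm_ge0 ?invr_ge0 //.
by rewrite invf_lt1 ?ltr1n ?ltr0n ?prime_gt1 ?prime_gt0.
Qed.

(** Extension by 0 at the multiples of p absorbs the condition that p does not divide k. The
    function stays Lipschitz because a congruence modulo p decides divisibility by p. *)
Definition unit_pow (i : int) (a : nat) : Qp := if (p %| a)%N then 0 else a%:R ^ i.

Lemma unit_pow_lipschitz i : padic_lipschitz (unit_pow i).
Proof.
have n1 a : `|unit_pow i a|_p <= 1.
  rewrite /unit_pow; case: ifPn => pa; first by rewrite padic_norm0.
  by rewrite padic_normXz padic_norm_nat_unit // exp1rz.
split=> // m a b ab; case: m => [|m] in ab *.
  by rewrite expr0 invr1 padic_norm_leB.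
have pab : (p %| a)%N = (p %| b)%N.
  rewrite /dvdn -(modn_dvdm a (dvdn_exp (isT : 0 < m.+1)%N (dvdnn p))) ab.
  by rewrite modn_dvdm // dvdn_exp.
rewrite /unit_pow -pab; case: ifPn => pa; first by rewrite subrr padic_norm0 expVp_ge0.
apply: padic_norm_leXzB; rewrite ?padic_norm_nat_unit -?pab //.
by rewrite padic_norm_natB_le; apply/eqP.
Qed.

Section Lipschitz.
Variables (g : nat -> Qp) (gL : padic_lipschitz g).

(** Induction on m: p consecutive blocks of length p^m.+1 agree termwise modulo p^m.+1, so their sum
    is p times the first one at that precision. One digit is lost in the base case, where p values
    are only known to be integral; this loss is the [m.+1] versus [m] in the estimates below. *)
Lemma lipschitz_block_sum s m :
  `|\sum_(0 <= a < p ^ m.+1) g (s + a)|_p <= p%:R ^- m.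
Proof.
elim: m => [|m IHm].
  by rewrite expr0 invr1 padic_norm_le_sum // => a _; case: gL.
rewrite expnS big_nat_mul; set P := (p ^ m.+1)%N in IHm *.
pose S := \sum_(0 <= a < P) g (s + a).
have -> : \sum_(0 <= i < p) \sum_(i * P <= j < i.+1 * P) g (s + j) =
    \sum_(0 <= i < p) (\sum_(0 <= j < P) (g (s + (j + i * P)) - g (s + j))) + p%:R * S.
  have SE : S *+ p = \sum_(0 <= i < p) S by rewrite sumr_const_nat subn0.
  rewrite mulr_natl SE -big_split /=.
  apply: eq_bigr => i _; rewrite sumrB subrK -{1}[(i * P)%N]add0n big_addn.
  by rewrite mulSn addnK.
apply: padic_norm_leD; last first.
  by rewrite exprS invfM padic_norm_leM ?padic_norm_p.
do 2 (apply: padic_norm_le_sum => [|? _]; first exact: expVp_ge0).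
by case: gL => _; apply; rewrite addnA addnC modnMDl.
Qed.

Definition psum (n : nat) := \sum_(0 <= a < n) g a.

Lemma psum_near m a b : (a = b %[mod p ^ m.+1])%N ->
  `|psum a - psum b|_p <= p%:R ^- m.
Proof.
wlog le_ba : a b / (b <= a)%N => [hw ab|/eqP].
  case/orP: (leq_total b a) => le; first exact: hw.
  by rewrite padic_norm_distC hw.
rewrite eqn_mod_dvd // => /dvdnP[k kE].
rewrite /psum (big_cat_nat _ le_ba) //= addrAC subrr add0r.
rewrite -{1}[b]add0n big_addn kE big_nat_mul.
apply: padic_norm_le_sum => [|i _]; first exact: expVp_ge0.
rewrite -{1}[(i * _)%N]add0n big_addn mulSn addnK.
rewrite (eq_bigr (fun j => g ((i * p ^ m.+1 + b) + j)%N)) => [|j _].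
  exact: lipschitz_block_sum.
by congr g; lia.
Qed.

(** Existence of the limits defining the polygamma functions, with an explicit rate that does not
    depend on z. *)
Lemma psum_ext z : `|z|_p <= 1 -> exists l, forall m n,
  `|n%:R - z|_p <= p%:R ^- m.+1 -> `|psum n - l|_p <= p%:R ^- m.
Proof.
move=> z1.
have /choice[c cP] m : exists n, `|z - n%:R|_p <= p%:R ^- m.+1.
  by have [n _ un] := padic_approx m.+1 z1; exists n.
have near m n n' : `|n%:R - z|_p <= p%:R ^- m.+1 -> `|z - n'%:R|_p <= p%:R ^- m.+1 ->
    `|psum n - psum n'|_p <= p%:R ^- m.
  move=> nz zn'; apply: psum_near; apply/eqP; rewrite -(padic_norm_natB_le p_pr).
  exact: padic_dist_trans nz zn'.
have [l lP] : exists l, forall m, `|psum (c m) - l|_p <= p%:R ^- m.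
  apply: padic_complete => m.
    by rewrite padic_norm_le_sum // => a _; case: gL.
  apply: near => //; rewrite padic_norm_distC (le_trans (cP _)) // expVp_le //.
exists l => m n nz; apply: padic_dist_trans (lP m); exact: near (cP m).
Qed.

Section WeightedSum.
Variables (N : nat) (N_gt1 : (1 < N)%N) (N_p : coprime N p) (psi : nat -> Qp).
Hypothesis psiP : forall k m n,
  `|n%:R - k%:R / N%:R|_p <= p%:R ^- m.+1 -> `|psum n - psi k|_p <= p%:R ^- m.

(* [N * a %/ p ^ m.+1] counts the [1 <= j < N] with [j * p ^ m.+1 < N * a], so
   the weighted sum is a sum of tails of [psum]; the tail for [j] starts at
   [(j * p ^ m.+1 + i) / N] with [i = N - j * p ^ m.+1 %% N], which is p-adically
   close to [i / N], and [j |-> i] permutes the interval [1, N[. *)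
Lemma psum_weighted m :
  `|\sum_(0 <= a < p ^ m.+1) (N * a %/ p ^ m.+1)%:R * g a +
    \sum_(1 <= k < N) psi k|_p <= p%:R ^- m.
Proof.
set P := (p ^ m.+1)%N.
have P0 : (0 < P)%N by rewrite expn_gt0 prime_gt0.
have N0 : (0 < N)%N by exact: ltnW.
have NP : coprime N P by rewrite coprimeXr.
have jP j : (0 < j < N)%N -> (0 < j * P %% N)%N.
  case/andP=> j0 jN; rewrite lt0n -/(N %| _)%N Gauss_dvdl //.
  by apply/negP => /dvdn_leq; lia.
have weightE a : (0 <= a < P)%N ->
    (N * a %/ P)%:R * g a = \sum_(1 <= j < N) (if (j * P %/ N < a)%N then g a else 0).
  case/andP=> _ aP; set c := (N * a %/ P)%N.
  have cN : (c < N)%N by rewrite ltn_divLR // ltn_pmul2l.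
  have cE : g a *+ c = \sum_(1 <= j < c.+1) g a by rewrite sumr_const_nat subn1.
  (* The count c is over the j with j P <= N a; equality never occurs, since N does not divide j P
     for 0 < j < N, so the strict inequality gives the same count. *)
  rewrite mulr_natl cE (big_nat_widen _ _ _ _ _ cN) big_mkcond /=.
  apply: eq_big_nat => j jN; congr (if _ then _ else _).
  rewrite ltnS leq_divRL // ltn_divLR // mulnC [(a * N)%N]mulnC ltn_neqAle mulnC.
  suff -> : (j * P != N * a)%N by [].
  by apply: contraTneq (jP _ jN) => ->; rewrite modnMr.
have tailE q : (q < P)%N ->
    \sum_(0 <= a < P) (if (q < a)%N then g a else 0) = psum P - psum q.+1.
  move=> qP; have -> : psum P = psum q.+1 + \sum_(q.+1 <= a < P) g a.
    by rewrite /psum -big_cat_nat.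
  by rewrite addrAC subrr add0r -big_mkcond [RHS](big_nat_widenl _ 0).
rewrite (eq_big_nat _ _ weightE) exchange_big_nat /=.
have -> : \sum_(1 <= k < N) psi k = \sum_(1 <= j < N) psi (N - j * P %% N)%N.
  have := @big_modM _ 0 +%R P N (fun i => psi (N - i)%N) N0.
  (* The index 0 is fixed by multiplication by P, and its term is cancelled on both sides. *)
  rewrite coprime_sym => /(_ NP); rewrite !(big_ltn N0) muln0 mod0n => /addrI.
  move=> sumE; apply/esym; transitivity
    (\sum_(1 <= j < N) psi (N - P * j %% N)%N); first by apply: eq_bigr => j _; rewrite mulnC.
  by rewrite sumE big_nat_rev; apply: eq_big_nat => j jN; congr psi; lia.
rewrite -big_split /= big_nat_cond.
apply: padic_norm_le_sum => [|j /andP[jN _]]; first exact: expVp_ge0.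
have qP : (j * P %/ N < P)%N by rewrite ltn_divLR // mulnC ltn_pmul2l //; case/andP: jN.
(* [psum P] is itself a block sum, hence small: each tail is - [psum q.+1] up to p^(-m). *)
rewrite tailE // -addrA [- _ + _]addrC; apply: padic_norm_leD.
  rewrite -[psum P]/(\sum_(0 <= a < P) g a) -[X in `|X|_p]/(\sum_(0 <= a < P) g (0 + a)%N).
  exact: lipschitz_block_sum.
set i := (N - _)%N; set q := (_ %/ _)%N in qP *.
have qE : (q.+1 * N = j * P + i)%N.
  have := divn_eq (j * P) N; have := ltn_pmod (j * P) N0.
  rewrite -/q /i mulSn; lia.
have NF0 : N%:R != 0 :> Qp by rewrite natr_padic_eq0 -lt0n.
rewrite padic_norm_distC; apply: psiP.
have -> : q.+1%:R - i%:R / N%:R = (j * P)%:R / N%:R :> Qp.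
  by apply: (mulIf NF0); rewrite mulrBl !divfK // -natrM qE natrD addrK.
have pN : ~~ (p %| N)%N by rewrite -prime_coprime // coprime_sym.
rewrite padic_norm_leMr // ?padic_norm_nat_le ?dvdn_mull //.
by rewrite padic_normV padic_norm_nat_unit // invr1.
Qed.
End WeightedSum.
End Lipschitz.
End LipschitzSums.

(** * The Teichmuller character *)

Section Teichmuller.
Variables (p : nat) (p_pr : prime p).
Local Notation Zp := (padic_int p_pr).
Local Notation Qp := (padic p_pr).
Local Notation q := (teichmuller_modulus p).
Local Notation omega := (@teichmuller p p_pr).
Local Notation "`| x |_p" := (@padic_norm p p_pr x) (at level 0, x at level 99).
Implicit Types (x y z w u : Qp) (e : rat) (i j : int) (a b n m : nat).

Lemma padic_norm_eq1X w k : (0 < k)%N -> w ^+ k = 1 -> `|w|_p = 1.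
Proof.
move=> k0 wk; apply/eqP; rewrite -(pexpr_eq1 k0) ?padic_norm_ge0 //.
by rewrite -padic_normX wk padic_norm1.
Qed.

Lemma padic_eq0_le x : (forall m, `|x|_p <= p%:R ^- m) -> x = 0.
Proof.
move=> x0; apply/eqP; rewrite -padic_norm_eq0 eq_le padic_norm_ge0 andbT leNgt.
apply/negP => x_gt0; have [m mx] := expVp_small p_pr (divr_gt0 x_gt0 (ltr0n _ 2)).
have := le_trans (x0 m) mx; lra.
Qed.

(** Each p-th power gains one digit: in v^p - 1 = (v - 1)(1 + v + ... + v^(p-1)) the second factor
    is congruent to p, hence to 0, modulo p. *)
Lemma padic_norm_exp_p M u : `|u - 1|_p <= p%:R^-1 ->
  `|u ^+ (p ^ M) - 1|_p <= p%:R ^- M.+1.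
Proof.
move=> u1; elim: M => [|M IHM]; first by rewrite expn0 !expr1.
rewrite expnSr exprM; set v := u ^+ (p ^ M) in IHM *.
have v1 : `|v - 1|_p <= p%:R^-1.
  by rewrite (le_trans IHM) // -[p%:R in X in _ <= X]expr1 expVp_le.
rewrite subrX1 exprSr invfM padic_norm_leM //.
rewrite -[X in `|X|_p](subrK p%:R) padic_norm_leD ?padic_norm_p //.
have -> : p%:R = \sum_(i < p) 1 :> Qp by rewrite sumr_const card_ord.
rewrite -sumrB padic_norm_le_sum // => [|i _]; first by rewrite invr_ge0.
have nv : `|v|_p <= 1.
  by rewrite -[v](subrK 1) padic_norm_leD ?padic_norm1 // (le_trans v1) //
    -[p%:R]expr1 expVp_le1.
by rewrite -[X in _ - X](expr1n _ i) padic_norm_leXB ?padic_norm1.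
Qed.

Lemma padic_norm_expz_near1 M u i : `|u - 1|_p <= p%:R^-1 ->
  `|i%:~R : Qp|_p <= p%:R ^- M -> `|u ^ i - 1|_p <= p%:R ^- M.
Proof.
move=> u1 iM.
have p1 : p%:R^-1 < 1 :> rat by rewrite invf_lt1 ?ltr1n ?ltr0n ?prime_gt1 ?prime_gt0.
have nu : `|u|_p = 1.
  by rewrite (padic_norm_eq (y := 1)) ?padic_norm1 // (le_lt_trans u1).
have /dvdzP[k ->] : ((p ^ M)%N %| i)%Z by rewrite dvdzE /= -(padic_norm_int_le p_pr).
rewrite mulrC -exprz_exp -[X in _ - X](exp1rz _ k) padic_norm_leXzB ?padic_norm1 //.
  by rewrite padic_normX nu expr1n.
by rewrite (le_trans (padic_norm_exp_p M u1)) // expVp_le.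
Qed.

(** The boolean is read as 0 or 1, so the exponent is 2 for p = 2 and 1 otherwise. *)
Lemma teichmuller_modulusE : q = (p ^ (p == 2).+1)%N.
Proof. by rewrite /teichmuller_modulus; case: eqVneq => [->|_]. Qed.

Lemma teichmuller_modulus_gt0 : (0 < q)%N.
Proof. by rewrite teichmuller_modulusE expn_gt0 prime_gt0. Qed.

Lemma coprime_teichmuller_modulus a : coprime a q = ~~ (p %| a)%N.
Proof. by rewrite teichmuller_modulusE coprime_pexpr // coprime_sym prime_coprime. Qed.

Lemma totient_modulus_gt0 : (0 < totient q)%N.
Proof. by rewrite totient_gt0 teichmuller_modulus_gt0. Qed.

Lemma totient_modulus_ltn : (totient q < q)%N.
Proof.
rewrite /teichmuller_modulus; case: eqVneq => // _.
by rewrite totient_prime // prednK ?prime_gt0.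
Qed.

Lemma invf_modulusE : q%:R^-1 = p%:R ^- (p == 2%N).+1 :> rat.
Proof. by rewrite teichmuller_modulusE natrX. Qed.

Lemma invf_modulus_le : q%:R^-1 <= p%:R^-1 :> rat.
Proof. by rewrite invf_modulusE -[p%:R in X in _ <= X]expr1 expVp_le. Qed.

(** If t = w / w' differed from 1, the sum of its powers t^i for i < phi(q) would vanish; as t is 1
    modulo q, this would make q divide phi(q), while 0 < phi(q) < q. *)
Lemma root_unity_eq w w' : w ^+ totient q = 1 -> w' ^+ totient q = 1 ->
  `|w - w'|_p <= q%:R^-1 -> w = w'.
Proof.
move=> wX w'X ww'; have k0 := totient_modulus_gt0.
have nw' := padic_norm_eq1X k0 w'X; have w'0 := padic_norm1_neq0 nw'.
have nt1 : `|w / w' - 1|_p <= q%:R^-1.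
  rewrite -(divff w'0) -mulrBl padic_normM padic_normV nw' invr1 mulr1 //.
have tX : (w / w') ^+ totient q = 1 by rewrite expr_div_n wX w'X divr1.
have nt := padic_norm_eq1X k0 tX.
move: tX nt nt1; move: (w / w') (divfK w'0 w) => t <- tX nt nt1.
move: tX => /eqP; rewrite -subr_eq0 subrX1 mulf_eq0 subr_eq0.
case/orP => [/eqP->|/eqP sum0]; first by rewrite mul1r.
have: `|(totient q)%:R : Qp|_p <= q%:R^-1.
  have -> : (totient q)%:R = - \sum_(i < totient q) (t ^+ i - 1) :> Qp.
    by rewrite sumrB sum0 sumr_const card_ord sub0r opprK.
  rewrite padic_normN padic_norm_le_sum ?invr_ge0 // => i _.
  by rewrite -[X in _ - X](expr1n _ i) padic_norm_leXB ?padic_norm1 ?nt.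
rewrite invf_modulusE padic_norm_nat_le -teichmuller_modulusE => /dvdn_leq.
by rewrite k0 leqNgt totient_modulus_ltn => /(_ isT).
Qed.

(** For p = 2 the root is the sign congruent to a modulo 4. For odd p it is the limit of a^(p^m), a
    Cauchy sequence by Euler's theorem. *)
Lemma teichmuller_ex a : ~~ (p %| a)%N ->
  exists w, w ^+ totient q = 1 /\ `|w - a%:R|_p <= q%:R^-1.
Proof.
move=> pa; rewrite invf_modulusE /teichmuller_modulus; case: eqVneq => [p2|_] /=.
  have {pa} : (odd a) by move: pa; rewrite p2 dvdn2 negbK.
  move=> oda.
  have [a1|a3] : (a %% 4 = 1 \/ a %% 4 = 3)%N by lia.
    exists 1; rewrite expr1n; split=> //.
    by rewrite -[1]/(1%:R) padic_norm_natB_le p2 a1.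
  exists (- 1); rewrite (_ : totient 4 = 2) // sqrrN expr1n; split=> //.
  rewrite padic_norm_distC opprK -[1]/(1%:R) -natrD padic_norm_nat_le p2.
  by rewrite /dvdn -modnDml a3.
have Euler m : (a ^ totient (p ^ m) = 1 %[mod p ^ m])%N.
  by apply: Euler_exp_totient; rewrite coprimeXr // coprime_sym prime_coprime.
pose v m : Qp := a%:R ^+ (p ^ m).
have v1 m : `|v m|_p <= 1 by rewrite padic_norm_leX ?padic_norm_nat_le1.
have eulerE m : `|v m ^+ p.-1 - 1|_p <= p%:R ^- m.+1.
  rewrite -exprM -natrX -[1]/(1%:R) padic_norm_natB_le.
  by have := Euler m.+1; rewrite totient_pfactor //= mulnC => ->.
have vS m : `|v m.+1 - v m|_p <= p%:R ^- m.+1.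
  rewrite [v m.+1](_ : _ = v m * v m ^+ p.-1); last first.
    by rewrite -exprS prednK ?prime_gt0 // -exprM -expnSr.
  by rewrite -[X in _ - X]mulr1 -mulrBr padic_norm_leMl.
have [l lP] : exists l, forall m, `|v m - l|_p <= p%:R ^- m.
  by apply: padic_complete => // m; rewrite (le_trans (vS m)) // expVp_le.
have l1 : `|l|_p <= 1 by rewrite -[l](subKr (v 0)) padic_norm_leB.
exists l; rewrite totient_prime //; split; last first.
  rewrite padic_norm_distC; apply: (padic_dist_trans (y := v 1)) (lP 1).
  by have := vS 0; rewrite {2}/v expr1 padic_norm_distC.
apply/eqP; rewrite -subr_eq0; apply/eqP/padic_eq0_le => m.
apply: (padic_dist_trans (y := v m ^+ p.-1)).
  by rewrite padic_norm_leXB // padic_norm_distC.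
by rewrite (le_trans (eulerE m)) // expVp_le.
Qed.

Lemma teichmullerP a : ~~ (p %| a)%N ->
  omega a ^+ totient q = 1 /\ `|omega a - a%:R|_p <= q%:R^-1.
Proof. by move=> /teichmuller_ex ex; exact: (xgetPex 0 ex). Qed.

Lemma teichmuller_norm1 a : ~~ (p %| a)%N -> `|omega a|_p = 1.
Proof. by case/teichmullerP => /(padic_norm_eq1X totient_modulus_gt0). Qed.

Lemma teichmuller_neq0 a : ~~ (p %| a)%N -> omega a != 0.
Proof. by move=> /teichmuller_norm1/padic_norm1_neq0. Qed.

Lemma teichmullerM a b : ~~ (p %| a)%N -> ~~ (p %| b)%N ->
  omega (a * b) = omega a * omega b.
Proof.
move=> pa pb; have pab : ~~ (p %| a * b)%N by rewrite Euclid_dvdM // negb_or pa.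
have [aX an] := teichmullerP pa; have [bX bn] := teichmullerP pb.
have [abX abn] := teichmullerP pab.
apply: root_unity_eq => //; first by rewrite exprMn aX bX mulr1.
apply: padic_dist_trans abn _.
rewrite natrM (_ : _ - _ = (a%:R - omega a) * b%:R + omega a * (b%:R - omega b)).
  apply: padic_norm_leD.
    by rewrite padic_norm_leMr ?padic_norm_nat_le1 // padic_norm_distC.
  by rewrite padic_norm_leMl ?teichmuller_norm1 // padic_norm_distC.
by rewrite mulrBl mulrBr subrKA.
Qed.

Lemma eq_mod_modulus_dvd a b : (a = b %[mod q])%N -> (p %| a)%N = (p %| b)%N.
Proof.
move=> ab; have pq : (p %| q)%N by rewrite teichmuller_modulusE dvdn_exp.
by rewrite /dvdn -(modn_dvdm a pq) ab modn_dvdm.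
Qed.

Lemma teichmuller_mod a b : (a = b %[mod q])%N -> ~~ (p %| a)%N -> omega a = omega b.
Proof.
move=> ab pa; have [aX an] := teichmullerP pa.
have pb : ~~ (p %| b)%N by rewrite -(eq_mod_modulus_dvd ab).
have [bX bn] := teichmullerP pb; apply: root_unity_eq => //.
apply: padic_dist_trans an _; apply: (padic_dist_trans (y := b%:R)).
  by rewrite invf_modulusE padic_norm_natB_le -teichmuller_modulusE; apply/eqP.
by rewrite padic_norm_distC.
Qed.

Lemma teichmuller_powM i a b :
  teichmuller_pow p_pr i (a * b) = teichmuller_pow p_pr i a * teichmuller_pow p_pr i b.
Proof.
rewrite /teichmuller_pow Euclid_dvdM //.
case: (boolP (p %| a)%N) => [_|pa] /=; first by rewrite mul0r.
case: (boolP (p %| b)%N) => [_|pb]; first by rewrite mulr0.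
by rewrite teichmullerM // exprzMl ?unitfE ?teichmuller_neq0.
Qed.

Lemma teichmuller_pow_mod i a b : (a = b %[mod q])%N ->
  teichmuller_pow p_pr i a = teichmuller_pow p_pr i b.
Proof.
move=> ab; have pab := eq_mod_modulus_dvd ab; rewrite /teichmuller_pow -pab.
by case: (boolP (p %| a)%N) => [//|pa]; congr (_ ^ i); exact: teichmuller_mod.
Qed.

Lemma teichmuller_powD i j a :
  teichmuller_pow p_pr i a * teichmuller_pow p_pr j a = teichmuller_pow p_pr (i + j) a.
Proof.
rewrite /teichmuller_pow; case: ifPn => pa; first by rewrite mulr0.
by rewrite expfzDr // teichmuller_neq0.
Qed.

Lemma teichmuller_pow1 i : teichmuller_pow p_pr i 1 = 1.
Proof.
have p1 : ~~ (p %| 1)%N by rewrite dvdn1 neq_ltn prime_gt1 ?orbT.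
have x0 : teichmuller_pow p_pr i 1 != 0.
  by rewrite /teichmuller_pow (negPf p1) expfz_neq0 // teichmuller_neq0.
by apply: (mulfI x0); rewrite -teichmuller_powM mul1n mulr1.
Qed.

Lemma teichmuller_pow_le1 i a : `|teichmuller_pow p_pr i a|_p <= 1.
Proof.
rewrite /teichmuller_pow; case: ifPn => pa; first by rewrite padic_norm0.
by rewrite padic_normXz teichmuller_norm1 // exp1rz.
Qed.

(** For a prime to p the quotient of the two terms is (a / omega(a))^(n - i), a small power of an
    element of 1 + pZ_p. It serves with i = - r for the weights and with i = 1 - r for the twist at
    N. *)
Lemma teichmuller_pow_near M i n a : `|(n%:Z - i)%:~R : Qp|_p <= p%:R ^- M ->
  `|teichmuller_pow p_pr (i - n%:Z) a * a%:R ^+ n - unit_pow p_pr i a|_p <= p%:R ^- M.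
Proof.
move=> ni; rewrite /teichmuller_pow /unit_pow; case: ifPn => pa.
  by rewrite mul0r subrr padic_norm0 expVp_ge0.
have [w0 nw] := (teichmuller_neq0 pa, teichmuller_norm1 pa).
have na : `|a%:R : Qp|_p = 1 by apply: padic_norm_nat_unit.
have a0 := padic_norm1_neq0 na.
have -> : a%:R ^+ n = a%:R ^ i * a%:R ^ (n%:Z - i) :> Qp.
  by rewrite -expfzDr // addrC subrK.
have -> : omega a ^ (i - n%:Z) = (omega a)^-1 ^ (n%:Z - i).
  by rewrite exprz_inv opprB.
rewrite mulrCA -exprzMl ?unitfE ?invr_eq0 // -[X in _ - X]mulr1 -mulrBr.
rewrite padic_norm_leMl //; first by rewrite padic_normXz na exp1rz.
apply: padic_norm_expz_near1 => //; rewrite -[X in _ - X](mulVf w0) -mulrBr padic_normM.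
rewrite padic_normV nw invr1 mul1r padic_norm_distC.
exact: le_trans (teichmullerP pa).2 invf_modulus_le.
Qed.
End Teichmuller.

(** * Bernoulli polynomials and power sums *)

Section RatrChar0.
Variable K : fieldType.
Hypothesis K0 : forall n, (n%:R == 0 :> K) = (n == 0%N).

Lemma intr_char0_eq0 (i : int) : (i%:~R == 0 :> K) = (i == 0).
Proof. by case: i => n; rewrite ?NegzE ?mulrNz ?oppr_eq0 K0. Qed.

(** [ratr] can be computed from any fraction equal to x, not only the reduced one; additivity and
    multiplicativity follow by clearing denominators. *)
Lemma ratr_char0E (x : rat) (i j : int) : j != 0 -> x * j%:~R = i%:~R ->
  ratr x * j%:~R = i%:~R :> K.
Proof.
move=> j0 xji; have d0 := denq_neq0 x.
have dK : (denq x)%:~R != 0 :> K by rewrite intr_char0_eq0.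
have dQ : (denq x)%:~R != 0 :> rat by rewrite intr_eq0.
have E : numq x * j = i * denq x.
  apply/eqP; rewrite -(eqr_int rat) !rmorphM /= -xji -{2}(divq_num_den x).
  by rewrite mulrAC divfK // mulrC.
apply: (mulIf dK); rewrite /ratr mulrAC divfK // -rmorphM E rmorphM //.
Qed.

Lemma ratr_char0D (x y : rat) : ratr (x + y) = ratr x + ratr y :> K.
Proof.
have [dx dy] := (denq_neq0 x, denq_neq0 y).
have dK : (denq x * denq y)%:~R != 0 :> K by rewrite intr_char0_eq0 mulf_neq0.
have xE : x * (denq x)%:~R = (numq x)%:~R by rewrite numqE.
have yE : y * (denq y)%:~R = (numq y)%:~R by rewrite numqE.
apply: (mulIf dK).
rewrite (ratr_char0E (i := numq x * denq y + numq y * denq x)) ?mulf_neq0 //.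
  rewrite mulrDl !rmorphM /= mulrA (ratr_char0E dx xE).
  by rewrite mulrCA (ratr_char0E dy yE) rmorphD !rmorphM /= [X in _ + X]mulrC.
by rewrite rmorphD !rmorphM /= -xE -yE; ring.
Qed.

Lemma ratr_char0M (x y : rat) : ratr (x * y) = ratr x * ratr y :> K.
Proof.
have [dx dy] := (denq_neq0 x, denq_neq0 y).
have dK : (denq x * denq y)%:~R != 0 :> K by rewrite intr_char0_eq0 mulf_neq0.
have xE : x * (denq x)%:~R = (numq x)%:~R by rewrite numqE.
have yE : y * (denq y)%:~R = (numq y)%:~R by rewrite numqE.
apply: (mulIf dK).
rewrite (ratr_char0E (i := numq x * numq y)) ?mulf_neq0 //.
  by rewrite !rmorphM /= mulrACA (ratr_char0E dx xE) (ratr_char0E dy yE).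
by rewrite !rmorphM /= -xE -yE; ring.
Qed.

Lemma ratr_char0_sum I (r : seq I) (F : I -> rat) :
  ratr (\sum_(i <- r) F i) = \sum_(i <- r) ratr (F i) :> K.
Proof.
elim: r => [|i r IHr]; last by rewrite !big_cons ratr_char0D IHr.
by rewrite !big_nil -[0 in LHS]/(0%:R) ratr_nat.
Qed.

End RatrChar0.

Section Bernoulli.

Lemma size_bernoulli_seq n : size (bernoulli_seq n) = n.
Proof. by elim: n => //= n IHn; rewrite size_rcons IHn. Qed.

Lemma nth_bernoulli_seq n k : (k < n)%N -> (bernoulli_seq n)`_k = bernoulli k.
Proof.
elim: n => // n IHn; rewrite ltnS leq_eqVlt => /predU1P[->//|kn] /=.
by rewrite nth_rcons size_bernoulli_seq kn IHn.
Qed.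

Lemma bernoulli_rec n :
  \sum_(k < n.+1) 'C(n.+1, k)%:R * bernoulli k = (n == 0%N)%:R.
Proof.
rewrite big_ord_recr /= binSn.
have -> : bernoulli n = ((n == 0%N)%:R - \sum_(k < n) 'C(n.+1, k)%:R * bernoulli k) / n.+1%:R.
  rewrite {1}/bernoulli /= nth_rcons size_bernoulli_seq ltnn eqxx.
  by congr ((_ - _) / _); apply: eq_bigr => k _; rewrite nth_bernoulli_seq.
by rewrite mulrC divfK ?pnatr_eq0 // addrC subrK.
Qed.

Lemma bernoulli_polyE n :
  bernoulli_poly n = \poly_(i < n.+1) ('C(n, i)%:R * bernoulli (n - i)).
Proof.
rewrite /bernoulli_poly poly_def (reindex_inj rev_ord_inj) /=.
apply: eq_bigr => i _; have le_in : (i <= n)%N by rewrite -ltnS.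
by rewrite subSS bin_sub // subKn.
Qed.

(** Telescoping of (j + 1)^(n+1) - j^(n+1). The coefficients are those of [bernoulli_rec]. *)
Lemma power_sum_rec (R : comNzRingType) n P :
  \sum_(k < n.+1) 'C(n.+1, k)%:R * \sum_(0 <= j < P) j%:R ^+ k = P%:R ^+ n.+1 :> R.
Proof.
elim: P => [|P IHP].
  by rewrite expr0n big1 // => k _; rewrite big_nil mulr0.
under eq_bigr do rewrite big_nat_recr //= mulrDr.
rewrite big_split /= IHP -natr1 exprDn.
rewrite (eq_bigr (fun i : 'I_n.+2 => P%:R ^+ (n.+1 - i) *+ 'C(n.+1, i))); last first.
  by move=> i _; rewrite expr1n mulr1.
rewrite [RHS]big_ord_recl /= subn0 bin0; congr (_ + _).
rewrite (reindex_inj rev_ord_inj) /=; apply: eq_bigr => i _.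
by rewrite /bump add1n bin_sub // mulr_natl.
Qed.

End Bernoulli.

Section BernoulliLimits.
Variables (p : nat) (p_pr : prime p).
Local Notation Qp := (padic p_pr).
Local Notation "`| x |_p" := (@padic_norm p p_pr x) (at level 0, x at level 99).
Implicit Types (x y z : Qp) (e : rat) (a b n m : nat).

Let K0 := natr_padic_eq0 p_pr.

Lemma natr_padic_neq0 n : (0 < n)%N -> n%:R != 0 :> Qp.
Proof. by rewrite K0 -lt0n. Qed.

Lemma expp_neq0 m : (p ^ m)%:R != 0 :> Qp.
Proof. by rewrite natr_padic_neq0 // expn_gt0 prime_gt0. Qed.

(* Dividing [power_sum_rec] by [P = p ^ m] and letting [m] tend to infinity gives
   the recurrence that defines the Bernoulli numbers. *)
Lemma tends_power_sum n :
  tends \oo%classic (fun m => (\sum_(0 <= j < p ^ m) j%:R ^+ n) / (p ^ m)%:R : Qp)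
    (ratr (bernoulli n)).
Proof.
elim/ltn_ind: n => n IHn; have n1 := natr_padic_neq0 (ltn0Sn n).
have -> : ratr (bernoulli n) =
    n.+1%:R^-1 * ((n == 0%N)%:R - \sum_(k < n) 'C(n.+1, k)%:R * ratr (bernoulli k)) :> Qp.
  apply: (mulfI n1); rewrite mulVKf //; apply/eqP; rewrite eq_sym subr_eq addrC; apply/eqP.
  rewrite -(ratr_nat Qp (n == 0%N)) -bernoulli_rec (ratr_char0_sum K0) big_ord_recr /=.
  rewrite binSn (ratr_char0M K0) ratr_nat; congr (_ + _).
  by apply: eq_bigr => i _; rewrite (ratr_char0M K0) ratr_nat.
(* After division by P the right-hand side is P^n, which yields the term [n = 0] of the Bernoulli
   recurrence. *)
have pw : tends \oo%classic (fun m => (p%:R ^+ m) ^+ n : Qp) (n == 0%N)%:R.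
  by apply: tends_eq (tendsX n (tends_expp p_pr)) _; rewrite expr0n.
apply: tends_ext (tendsZ n.+1%:R^-1 (tendsB pw (tends_sum (index_enum _)
  (P := xpredT) (fun (k : 'I_n) _ => tendsZ 'C(n.+1, k)%:R (IHn k (ltn_ord k)))))) => m.
apply: (mulfI n1); rewrite mulVKf //; apply: (mulIf (expp_neq0 m)).
rewrite -[RHS]mulrA (divfK (expp_neq0 m)) mulrBl mulr_suml.
rewrite -natrX -exprSr; apply/eqP; rewrite subr_eq -power_sum_rec big_ord_recr /= binSn addrC.
apply/eqP; congr (_ + _); apply: eq_bigr => k _.
by rewrite mulrA divfK ?expp_neq0.
Qed.

(** The Volkenborn integral of (j + x)^n, obtained from that of the powers of j by the binomial
    theorem. *)
Lemma tends_shifted_power_sum n x :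
  tends \oo%classic (fun m => (\sum_(0 <= j < p ^ m) (j%:R + x) ^+ n) / (p ^ m)%:R)
    (map_poly ratr (bernoulli_poly n)).[x].
Proof.
have size_le : (size (map_poly ratr (bernoulli_poly n) : {poly Qp}) <= n.+1)%N.
  by rewrite (leq_trans (size_poly _ _)) // bernoulli_polyE size_poly.
rewrite (horner_coef_wide _ size_le).
have r0 : ratr 0 = 0 :> Qp by rewrite -[0 in LHS]/(0%:R) ratr_nat.
rewrite (eq_bigr (fun i : 'I_n.+1 => 'C(n, i)%:R * x ^+ i * ratr (bernoulli (n - i))));
  last first.
  move=> i _; rewrite coef_map_id0 // bernoulli_polyE coef_poly ltn_ord.
  by rewrite (ratr_char0M K0) ratr_nat mulrAC.
have lim_i (i : 'I_n.+1) := tendsZ (FF := eventually_filter)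
  ('C(n, i)%:R * x ^+ i) (tends_power_sum (n - i)).
have lim_sum := tends_sum (FF := eventually_filter) (index_enum 'I_n.+1)
  (P := xpredT) (fun i _ => lim_i i).
apply: tends_ext lim_sum => m.
rewrite (eq_bigr (fun i : 'I_n.+1 => ('C(n, i)%:R * x ^+ i *
  \sum_(0 <= j < p ^ m) j%:R ^+ (n - i)) / (p ^ m)%:R)) => [|i _]; last by rewrite mulrA.
rewrite -mulr_suml; congr (_ / _); under eq_bigr do rewrite mulr_sumr.
rewrite exchange_big /=; apply: eq_bigr => j _; rewrite exprDn.
by apply: eq_bigr => i _; rewrite -[RHS]mulr_natl [RHS]mulrA mulrAC.
Qed.

(** Write a = j f + b with 1 <= b <= f, so that a^n = f^n (j + b / f)^n. The range starts at 1 and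
    includes p^m f, as in [gen_bernoulli]: for chi = 1 and n = 1 the range starting at 0 would give
    -1/2 instead of 1/2. *)
Lemma tends_gen_bernoulli (f n : nat) (chi : nat -> Qp) : (0 < f)%N -> (0 < n)%N ->
  (forall a, chi (a + f)%N = chi a) ->
  tends \oo%classic (fun m => (\sum_(1 <= a < (p ^ m * f).+1) chi a * a%:R ^+ n) / (p ^ m)%:R)
    (f%:R * gen_bernoulli f chi n).
Proof.
move=> f0 n0 chif; have fK := natr_padic_neq0 f0.
have chi_per j a : chi (a + j * f)%N = chi a.
  by elim: j => [|j IHj]; rewrite ?addn0 // mulSn addnCA addnA [(f + a)%N]addnC addnAC chif.
have lim_b b := tendsZ (FF := eventually_filter) (chi b.+1)
  (tends_shifted_power_sum n (b.+1%:R / f%:R)).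
have lim_sum := tendsZ (FF := eventually_filter) (f%:R ^+ n)
  (tends_sum (FF := eventually_filter) (index_iota 0 f) (P := xpredT) (fun b _ => lim_b b)).
have -> : f%:R * gen_bernoulli f chi n = f%:R ^+ n * \sum_(0 <= b < f)
    chi b.+1 * (map_poly ratr (bernoulli_poly n)).[b.+1%:R / f%:R].
  rewrite /gen_bernoulli big_add1 /= mulrA; congr (_ * _).
  case: n n0 {lim_b lim_sum} => // n _; rewrite exprS.
  by have -> : n.+1%:Z - 1 = n by rewrite -addn1 PoszD addrK.
apply: tends_ext lim_sum => m.
rewrite big_add1 /= big_nat_mul mulr_sumr.
rewrite (eq_big_nat _ _ (F2 := fun b => f%:R ^+ n *
  (chi b.+1 * \sum_(0 <= j < p ^ m) (j%:R + b.+1%:R / f%:R) ^+ n) / (p ^ m)%:R)) => [|b _];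
  last by rewrite !mulrA.
rewrite -mulr_suml; congr (_ / _).
rewrite (eq_big_nat _ _ (F2 := fun b => \sum_(0 <= j < p ^ m)
    chi b.+1 * (j * f + b.+1)%:R ^+ n)) => [|b _].
  rewrite exchange_big_nat /=; apply: eq_big_nat => j _.
  rewrite -[in RHS](add0n (j * f)%N) big_addn mulSn addnK; apply: eq_big_nat => b _.
  by rewrite -addSn chi_per addnC.
rewrite mulrCA mulr_sumr mulr_sumr; apply: eq_big_nat => j _; congr (_ * _).
by rewrite -exprMn mulrDr mulrCA divff // mulr1 natrD natrM mulrC.
Qed.

End BernoulliLimits.

(** * Values of the p-adic L-function *)

Lemma sum_shift_endpoints (V : nmodType) (P : nat) (f : nat -> V) : (0 < P)%N ->
  f 0%N = 0 -> f P = 0 -> \sum_(1 <= a < P.+1) f a = \sum_(0 <= a < P) f a.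
Proof.
move=> P0 f0 fP; rewrite big_nat_recr //= fP addr0.
by rewrite [RHS](big_ltn P0) f0 add0r.
Qed.

Lemma opp_mulK (K : fieldType) (x y z : K) : z != 0 -> - (z * (- x * y / z)) = x * y.
Proof. by move=> z0; rewrite mulrC divfK // mulNr opprK. Qed.

(** Meant for x = p^m and y = p, with A and B the sums of n-th powers up to x y and up to x: the
    factor 1 - p^(n-1) amounts to removing the multiples of p. *)
Lemma euler_factor (K : fieldType) (x y A B : K) n : (0 < n)%N -> x != 0 -> y != 0 ->
  A / (x * y) - y ^ (n%:Z - 1) * (B / x) = (A - B * y ^+ n) / (x * y).
Proof.
case: n => // n _ x0 y0; have -> : n.+1%:Z - 1 = n by rewrite -addn1 PoszD addrK.
by rewrite -exprnP exprS; field; rewrite x0 y0.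
Qed.

Section LValue.
Variables (p : nat) (p_pr : prime p).
Local Notation Qp := (padic p_pr).
Local Notation q := (teichmuller_modulus p).
Local Notation "`| x |_p" := (@padic_norm p p_pr x) (at level 0, x at level 99).
Implicit Types (x y z : Qp) (a b n m : nat).

(** * The primitive character attached to a power of omega *)

Section Primitive.
Variable i : int.
Local Notation chi := (teichmuller_pow p_pr i).
Let trivial_mod d := [forall a : 'I_q,
  coprime a q && (a == 1 %[mod d])%N ==> (chi a == 1)].

Let q_gt1 : (1 < q)%N.
Proof. exact: leq_ltn_trans (totient_modulus_gt0 p_pr) (totient_modulus_ltn p_pr). Qed.

Let q_gt0 : (0 < q)%N := ltnW q_gt1.

Lemma conductor_trivial : trivial_mod 1 -> conductor q chi = 1%N.
Proof.
move=> tr1; rewrite /conductor -/trivial_mod; set s := [seq _ <- _ | _].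
have s1 : 1%N \in s.
  rewrite mem_filter -(dvdn_divisors _ q_gt0) dvd1n andbT; exact: tr1.
have: sorted ltn s by rewrite sorted_filter ?sorted_divisors_ltn //; exact: ltn_trans.
have: all (leq 1) s.
  apply/allP => d; rewrite mem_filter -(dvdn_divisors _ q_gt0) => /andP[_].
  exact: dvdn_gt0.
case: s s1 => // x s; rewrite inE => /predU1P[<- //|s1] /= /andP[x0 _].
by move=> /(order_path_min ltn_trans)/allP/(_ _ s1) /=; rewrite ltnNge x0.
Qed.

(** The only divisor of q strictly between 1 and q is 2, for p = 2. It is excluded because every a
    prime to 4 is 1 modulo 2, so triviality modulo 2 implies triviality modulo 1. *)
Lemma conductor_nontrivial : ~~ trivial_mod 1 -> conductor q chi = q.
Proof.
move=> tr1; rewrite /conductor -/trivial_mod; set s := [seq _ <- _ | _].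
have qs : q \in s.
  rewrite mem_filter -(dvdn_divisors _ q_gt0) dvdnn andbT.
  apply/forallP => a; apply/implyP => /andP[_ /eqP a1].
  by rewrite (teichmuller_pow_mod _ _ a1) teichmuller_pow1.
have: head q s \in s by case: s qs => // x s _; rewrite mem_head.
rewrite mem_filter -(dvdn_divisors _ q_gt0) teichmuller_modulusE // => /andP[+ /dvdn_pfactor].
move=> + /(_ p_pr)[k]; rewrite -teichmuller_modulusE // => + + dE; rewrite dE.
case: k {dE} => [|k]; first by rewrite expn0 => tr; case/negP: tr1.
move=> tr2; rewrite ltnS leq_eqVlt => /predU1P[->|]; first by rewrite -teichmuller_modulusE.
move: tr2; case: eqVneq => //= p2 tr2; rewrite ltnS leqn0 => /eqP k0.
case/negP: tr1; move: tr2; rewrite k0 expn1 => tr2.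
apply/forallP => a; apply/implyP => /andP[aq _].
have := forallP tr2 a; rewrite aq /= => /implyP; apply.
move: aq; rewrite coprime_teichmuller_modulus //; move: (nat_of_ord a) => c.
by rewrite p2 dvdn2 negbK !modn2 => ->.
Qed.

(** The value is 1 at the multiples of p too, in contrast with [chi]; this is the only case in which
    the Euler factor differs from 1. *)
Lemma primitive_char_trivial a : trivial_mod 1 -> primitive_char q chi a = 1.
Proof.
move=> tr1; rewrite /primitive_char conductor_trivial //.
case: pickP => [b /andP[bq _]|/(_ (Ordinal q_gt1))].
  by apply/eqP/(implyP (forallP tr1 b)); rewrite bq !modn1.
by rewrite /= coprime1n !modn1.
Qed.

Lemma primitive_char_nontrivial a : ~~ trivial_mod 1 -> primitive_char q chi a = chi a.
Proof.
move=> tr1; rewrite /primitive_char conductor_nontrivial //.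
case: pickP => [b /andP[_ /eqP]|nob]; first exact: teichmuller_pow_mod.
rewrite /teichmuller_pow; case: ifPn => // pa.
have := nob (Ordinal (ltn_pmod a (ltnW q_gt1))).
by rewrite /= modn_mod eqxx andbT coprime_modl coprime_teichmuller_modulus // pa.
Qed.

Lemma chi_trivial a : trivial_mod 1 -> chi a = (~~ (p %| a)%N)%:R.
Proof.
move=> tr1; case: (boolP (p %| a)%N) => pa; first by rewrite /teichmuller_pow pa.
have am : (a = a %% q %[mod q])%N by rewrite modn_mod.
rewrite (teichmuller_pow_mod _ _ am).
apply/eqP/(implyP (forallP tr1 (Ordinal (ltn_pmod a (ltnW q_gt1))))).
by rewrite /= coprime_modl coprime_teichmuller_modulus // pa !modn1.
Qed.

Lemma chi_sum_shift n m : (0 < m)%N ->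
  \sum_(1 <= a < (p ^ m).+1) chi a * a%:R ^+ n = \sum_(0 <= a < p ^ m) chi a * a%:R ^+ n.
Proof.
move=> m0; have P0 : (0 < p ^ m)%N by rewrite expn_gt0 prime_gt0.
have chi0 a : (p %| a)%N -> chi a * a%:R ^+ n = 0.
  by move=> pa; rewrite /teichmuller_pow pa mul0r.
apply: (sum_shift_endpoints (f := fun a => chi a * a%:R ^+ n)) => //.
  exact/chi0/dvdn0.
exact/chi0/dvdn_exp.
Qed.

End Primitive.

Lemma sum_not_dvd (f : nat -> Qp) P :
  \sum_(1 <= a < (P * p).+1) (~~ (p %| a)%N)%:R * f a =
  \sum_(1 <= a < (P * p).+1) f a - \sum_(1 <= b < P.+1) f (b * p)%N.
Proof.
rewrite [X in _ - X]big_add1 /=.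
have -> : \sum_(0 <= b < P) f (b.+1 * p)%N = \sum_(1 <= a < (P * p).+1) (p %| a)%:R * f a.
  rewrite big_add1 /= big_nat_mul; apply: eq_big_nat => j _.
  rewrite -[in RHS](add0n (j * p)%N) big_addn mulSn addnK.
  have p0 := prime_gt0 p_pr; have pE := prednK p0.
  rewrite (bigD1_seq p.-1) ?mem_index_iota ?iota_uniq ?prednK //=.
  rewrite big_seq_cond big1 => [|b /andP[]]; last first.
    rewrite mem_index_iota => /andP[_ bp] bp1.
    rewrite -addSn dvdn_addl ?dvdn_mull // gtnNdvd ?mul0r //; lia.
  by rewrite addr0 -addSn pE dvdn_addr // dvdn_mull // mul1r.
rewrite -sumrB; apply: eq_bigr => a _.
by case: (p %| a)%N; rewrite ?mul1r ?mul0r ?subrr ?subr0.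
Qed.

(** The vanishing of [teichmuller_pow] at the multiples of p accounts for the Euler factor: for a
    trivial character it removes those terms, otherwise psi(p) = 0. *)
Lemma tends_L_value (r : int) n : (0 < n)%N ->
  tends \oo%classic (fun m =>
    (\sum_(0 <= a < p ^ m) teichmuller_pow p_pr (1 - r - n%:Z) a * a%:R ^+ n) / (p ^ m)%:R)
  (- (n%:R * padic_L_value q (teichmuller_pow p_pr (1 - r)) n)).
Proof.
move=> n0; rewrite /padic_L_value (lcmn_idPr (dvdnn q)).
have -> : (fun a => teichmuller_pow p_pr (1 - r) a * teichmuller_pow p_pr (- n%:Z) a) =
    teichmuller_pow p_pr (1 - r - n%:Z).
  by apply/funext => a; rewrite teichmuller_powD.
set i := 1 - r - n%:Z; rewrite (opp_mulK _ _ (natr_padic_neq0 p_pr n0)).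
have [tr|ntr] := boolP [forall a : 'I_q,
  coprime a q && (a == 1 %[mod 1])%N ==> (teichmuller_pow p_pr i a == 1)].
  rewrite (conductor_trivial tr) (primitive_char_trivial _ tr) mul1r.
  have -> : primitive_char q (teichmuller_pow p_pr i) = fun=> 1.
    by apply/funext => a; rewrite primitive_char_trivial.
  have lim1 := @tends_gen_bernoulli p p_pr 1 n (fun=> 1) isT n0 (fun=> erefl).
  rewrite mul1r in lim1.
  apply: (@tends_oo_shift _ _ _ _ 1).
  have lim2 := tendsB (FF := eventually_filter) (tends_oo_subseq 1 lim1)
    (tendsZ (FF := eventually_filter) (p%:R ^ (n%:Z - 1)) lim1).
  rewrite mulrBl mul1r; apply: tends_ext lim2 => m.
  rewrite -chi_sum_shift ?addn1 // !muln1.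
  rewrite [in RHS](eq_bigr (fun a => (~~ (p %| a)%N)%:R * a%:R ^+ n)); last first.
    by move=> a _; rewrite chi_trivial.
  rewrite expnSr sum_not_dvd.
  under eq_bigr do rewrite mul1r; under [X in _ - _ * (X / _)]eq_bigr do rewrite mul1r.
  under [X in _ = (_ - X) / _]eq_bigr do rewrite natrM exprMn.
  by rewrite -mulr_suml natrM euler_factor // ?natr_padic_neq0 ?expn_gt0 ?prime_gt0.
have -> : primitive_char q (teichmuller_pow p_pr i) = teichmuller_pow p_pr i.
  by apply/funext => a; rewrite primitive_char_nontrivial.
have chip : teichmuller_pow p_pr i p = 0 by rewrite /teichmuller_pow dvdnn.
rewrite (conductor_nontrivial ntr) chip mul0r subr0 mul1r.
have q0 := teichmuller_modulus_gt0 p_pr.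
have lim1 := @tends_gen_bernoulli p p_pr q n (teichmuller_pow p_pr i) q0 n0
  (fun a => teichmuller_pow_mod p_pr i (modnDr a q)).
have qK := natr_padic_neq0 p_pr q0.
(* With this shift p^m becomes p^m q, a whole number of periods of the character. *)
apply: (@tends_oo_shift _ _ _ _ (p == 2%N).+1).
apply: tends_eq (mulKf qK _).
apply: tends_ext (tendsZ (FF := eventually_filter) q%:R^-1 lim1) => m.
rewrite -[in RHS]chi_sum_shift ?addnS // -addnS expnD -teichmuller_modulusE.
by rewrite [LHS]mulrC natrM invfM [RHS]mulrA.
Qed.
End LValue.

(** * The p-adic logarithm *)

Lemma bin_div_swap (K : fieldType) (n k c d x : K) : n != 0 -> k != 0 ->
  n * d = k * c -> c * x / n = d * (x / k).
Proof.
move=> n0 k0 E; apply: (mulfI n0); rewrite [RHS]mulrA E.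
by field; rewrite n0 k0.
Qed.

Section PadicLog.
Variables (p : nat) (p_pr : prime p).
Local Notation Qp := (padic p_pr).
Local Notation "`| x |_p" := (@padic_norm p p_pr x) (at level 0, x at level 99).
Implicit Types (x y z : Qp) (a b n m k : nat).

(** If v is the valuation of k, then 2^v <= p^v <= k forces 2v <= k, and the norm is at most p^(-(k
    - v)) with k - v >= k / 2 >= M. *)
Lemma padic_norm_expdiv M x k : `|x|_p <= p%:R^-1 -> (M.*2 <= k)%N ->
  `|x ^+ k / k%:R|_p <= p%:R ^- M.
Proof.
move=> x1 Mk; have [->|k0] := posnP k.
  by rewrite invr0 mulr0 padic_norm0 expVp_ge0.
set v := logn p k; have kE : k = (p ^ v * k`_p^')%N by rewrite -p_part partnC.
have pk' : ~~ (p %| k`_p^')%N.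
  by rewrite -p'natE // part_pnat.
have vk : (v.*2 <= k)%N.
  have : (2 ^ v <= k)%N.
    apply: leq_trans (dvdn_leq k0 (pfactor_dvdnn p k)).
    by rewrite -/v; case: (v) => // w; rewrite leq_exp2r // prime_gt1.
  by case: (v) => // w; have := ltn_expl w (ltnSn 1); rewrite expnS; lia.
have nk : `|k%:R : Qp|_p = p%:R ^- v.
  rewrite kE natrM natrX padic_normM padic_normX padic_norm_p.
  by rewrite padic_norm_nat_unit // mulr1 exprVn.
rewrite padic_normM padic_normV padic_normX nk invrK.
apply: le_trans (_ : p%:R ^- k * p%:R ^+ v <= _).
  by rewrite ler_pM2r ?exprn_gt0 ?ltr0n ?prime_gt0 // -exprVn lerXn2r
    ?nnegrE ?padic_norm_ge0 ?invr_ge0.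
have kv : (k = v + (k - v))%N by lia.
have pv0 : p%:R ^+ v != 0 :> rat by rewrite expf_neq0 // pnatr_eq0 -lt0n prime_gt0.
rewrite kv exprD invfM mulrAC mulVf // mul1r expVp_le //; lia.
Qed.

(** By Pascal's rule C(P-1, k+1) = C(P, k+1) - C(P-1, k), where C(P, k+1) = P C(P-1, k) / (k+1)
    tends to 0. *)
Lemma tends_bin_pred k :
  tends \oo%classic (fun m => 'C((p ^ m).-1, k)%:R : Qp) ((-1) ^+ k).
Proof.
elim: k => [|k IHk].
  by rewrite expr0; apply: tends_ext (tends_cst (p_pr := p_pr) 1) => m; rewrite bin0.
have kK := natr_padic_neq0 p_pr (ltn0Sn k).
have lim1 := tendsB (FF := eventually_filter)
  (tendsM (FF := eventually_filter) (tends_expp p_pr)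
    (tendsZ (FF := eventually_filter) k.+1%:R^-1 IHk)) IHk.
rewrite mul0r sub0r in lim1; rewrite exprS mulN1r; apply: tends_ext lim1 => m.
have P0 : (0 < p ^ m)%N by rewrite expn_gt0 prime_gt0.
rewrite mulrCA -natrX -natrM mul_bin_diag natrM mulKf //.
by rewrite -{1}(prednK P0) binS natrD addrK.
Qed.

Lemma exprD1_sub1_div x n : (0 < n)%N ->
  ((1 + x) ^+ n - 1) / n%:R = \sum_(1 <= k < n.+1) 'C(n.-1, k.-1)%:R * (x ^+ k / k%:R).
Proof.
move=> n0; have nK := natr_padic_neq0 p_pr n0.
rewrite exprDn -(big_mkord xpredT (fun i => 1 ^+ (n - i) * x ^+ i *+ 'C(n, i))).
rewrite big_ltn // expr1n expr0 mulr1 bin0 addrC addKr mulr_suml.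
apply: eq_big_nat => k /andP[k0 _]; have kK := natr_padic_neq0 p_pr k0.
rewrite expr1n mul1r -mulr_natl; apply: bin_div_swap => //.
by rewrite -!natrM mul_bin_diag prednK.
Qed.

(** By [exprD1_sub1_div] the quotient expands with coefficients C(P-1, k-1) / k, which tend to those
    of the logarithm series, while the tails are small uniformly in m. *)
Lemma padic_logE (y l : Qp) : `|y - 1|_p <= p%:R^-1 ->
  tends \oo%classic (fun m => (y ^+ (p ^ m) - 1) / (p ^ m)%:R) l -> padic_log y = l.
Proof.
(* Terms of index at least 2M have norm at most p^(-M); the extra 1 makes K positive. *)
move=> y1 yl; apply: tends_lim; apply/tends_ooP => M; exists M.*2.+1 => K MK.
set S := \sum_(1 <= k < K) _.
have trunc : tends \oo%classic
    (fun m => \sum_(1 <= k < K) 'C((p ^ m).-1, k.-1)%:R * ((y - 1) ^+ k / k%:R)) S.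
  rewrite /S [X in tends _ _ X](eq_big_nat _ _
    (F2 := fun k => (-1) ^+ k.-1 * ((y - 1) ^+ k / k%:R))) => [|k /andP[k0 _]].
    apply: tends_sum => k _.
    exact: tendsM (tends_bin_pred k.-1) (tends_cst _).
  rewrite -mulrA; case: k k0 => // k _; congr (_ * _).
  by rewrite !exprS !mulN1r opprK.
have diff := tendsB (FF := eventually_filter) trunc yl.
apply: tends_le (expVp_gt0 p_pr M) diff _.
exists K => // m /= Km.
have P0 : (0 < p ^ m)%N by rewrite expn_gt0 prime_gt0.
have KP : (K <= (p ^ m).+1)%N.
  by rewrite leqW // (leq_trans Km) // ltnW // ltn_expl // prime_gt1.
rewrite -{2}[y](subrKC 1) exprD1_sub1_div // padic_norm_distC.
have K0 : (0 < K)%N by exact: leq_trans MK.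
rewrite (big_cat_nat K0 KP) /= addrAC subrr add0r big_nat_cond.
apply: padic_norm_le_sum => [|k /andP[/andP[Kk _] _]]; first exact: expVp_ge0.
rewrite padic_norm_leMl ?padic_norm_nat_le1 // padic_norm_expdiv //.
exact: leq_trans (ltnW MK) Kk.
Qed.
End PadicLog.

(** * Sums of polygamma values *)

Lemma exprD_rem_rec (R : comNzRingType) (x y : R) n :
  (x + y) ^+ n.+2 - x ^+ n.+2 - n.+2%:R * x ^+ n.+1 * y =
  (x + y) * ((x + y) ^+ n.+1 - x ^+ n.+1 - n.+1%:R * x ^+ n * y) +
  n.+1%:R * x ^+ n * (y * y).
Proof.
rewrite ![_ ^+ n.+2]exprS ![_ ^+ n.+1]exprS -[n.+2%:R]natr1.
by move: (_ ^+ n) (x ^+ n) n.+1%:R => a b c; ring.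
Qed.

Lemma prod1B_rem_rec (R : comNzRingType) (y P S : R) :
  (1 - y) * P - 1 + (y + S) = (1 - y) * (P - 1 + S) + y * S.
Proof. by ring. Qed.

Lemma transform_term (R : comNzRingType) (u v N a P c k : R) n :
  u * v * (N * a - P * c) ^+ n.+1 - u * N ^+ n.+1 * (v * a ^+ n.+1) +
    k * P * (u * N ^+ n) * (c * (v * a ^+ n)) =
  u * v * ((N * a - P * c) ^+ n.+1 - (N * a) ^+ n.+1 - k * (N * a) ^+ n * - (P * c)).
Proof. by rewrite !exprMn !exprS; ring. Qed.

Lemma opp_twisted_comb (R : comNzRingType) (k C B V S : R) :
  - (k * ((1 - C) * V + B * S)) = (1 - C) * - (k * V) + k * B * - S.
Proof. by ring. Qed.

(** D' is the weighted sum that the reindexing produces and D the one with weights a^(-r). The first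
    quotient carries the error modulo P^2, the second term the cost of replacing D' by D. *)
Lemma twisted_quotient_split (K : fieldType) (k C B T D D' P : K) : P != 0 ->
  (1 - C) * (T / P) + k * B * D =
  ((1 - C) * T + k * P * B * D') / P + k * (B * (D - D')).
Proof. by move=> P0; field; rewrite P0. Qed.

(** Here x = N^r, c = N^(1-r), and S is the sum of the polygamma values. *)
Lemma solve_L_value (K : fieldType) (N x c S : K) : N != 0 -> x != 0 ->
  c = N / x -> 1 - c != 0 -> (N - x) * (- (c / N * S) / (1 - c)) = S.
Proof.
move=> N0 x0 -> c1; have xN : x - N != 0.
  by apply: contraNneq c1 => /eqP; rewrite subr_eq0 => /eqP<-; rewrite divff ?subrr.
by field; rewrite N0 x0 xN.
Qed.

Lemma unit_factor (K : fieldType) (N a P c : K) : N != 0 -> a != 0 ->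
  N * a - P * c = N * a * (1 - P / N * (c * a ^ (- 1))).
Proof. by move=> N0 a0; rewrite exprN1; field; rewrite N0 a0. Qed.

Lemma polygamma_cancel (K : fieldType) (N p S : K) : N != 0 -> p != 0 ->
  S = N / p * (p / N * S).
Proof. by move=> N0 p0; field; rewrite N0 p0. Qed.

Lemma quotient_remainder (K : fieldType) (Z p q N D Pi : K) : q != 0 -> Z * Pi = 1 ->
  (Z - 1) / q - Z * (p / N * D) = - (Z * (Pi - 1 + p * q / N * D) / q).
Proof.
move=> q0 ZPi; apply: (mulIf q0); rewrite mulrBl mulNr !divfK //.
rewrite mulrDr mulrBr ZPi; ring.
Qed.

Section PolygammaSum.
Variables (p : nat) (p_pr : prime p).
Local Notation Qp := (padic p_pr).
Local Notation q := (teichmuller_modulus p).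
Local Notation "`| x |_p" := (@padic_norm p p_pr x) (at level 0, x at level 99).
Implicit Types (x y z : Qp) (a b n m k : nat) (e : rat).

Lemma padic_norm_exprD_rem x y n e : `|x|_p <= 1 -> `|y|_p <= e -> e <= 1 ->
  `|(x + y) ^+ n.+1 - x ^+ n.+1 - n.+1%:R * x ^+ n * y|_p <= e * e.
Proof.
move=> x1 ye e1; have e0 : 0 <= e := le_trans (padic_norm_ge0 _) ye.
have y1 := le_trans ye e1.
elim: n => [|n IHn].
  by rewrite !expr1 expr0 !mul1r addrAC addrK subrr padic_norm0 mulr_ge0.
rewrite exprD_rem_rec; apply: padic_norm_leD.
  by rewrite padic_norm_leMl // padic_norm_leD.
rewrite padic_norm_leMl ?padic_norm_leM //.
exact: padic_norm_leMl (padic_norm_nat_le1 _ _) (padic_norm_leX _ x1).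
Qed.

Lemma padic_norm_prod1B_rem (I : Type) (r : seq I) (f : I -> Qp) e :
  (forall i, `|f i|_p <= e) -> 0 <= e <= 1 ->
  `|\prod_(i <- r) (1 - f i) - 1 + \sum_(i <- r) f i|_p <= e * e.
Proof.
move=> fe /andP[e0 e1]; elim: r => [|i r IHr].
  by rewrite !big_nil subrr addr0 padic_norm0 mulr_ge0.
rewrite !big_cons prod1B_rem_rec; apply: padic_norm_leD.
  rewrite padic_norm_leMl // padic_norm_leB ?padic_norm1 //.
  exact: le_trans (fe i) e1.
by rewrite padic_norm_leM // padic_norm_le_sum.
Qed.

Lemma psum_unit_pow i n :
  psum (unit_pow p_pr i) n = \sum_(1 <= k < n | ~~ (p %| k)%N) k%:R ^ i.
Proof.
rewrite /psum; case: n => [|n]; first by rewrite !big_geq.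
rewrite big_ltn // {1}/unit_pow dvdn0 add0r [RHS]big_mkcond /=.
by apply: eq_bigr => k _; rewrite /unit_pow; case: (p %| k)%N.
Qed.

Lemma padic_polygammaP r z : `|z|_p <= 1 -> forall m n,
  `|n%:R - z|_p <= p%:R ^- m.+1 ->
  `|psum (unit_pow p_pr (- r)) n - padic_polygamma (r - 1) z|_p <= p%:R ^- m.
Proof.
move=> z1; have [l lP] := psum_ext (unit_pow_lipschitz p_pr (- r)) z1.
suff -> : padic_polygamma (r - 1) z = l by [].
rewrite /padic_polygamma subrK; have zF := posnat_near_proper z1.
apply: tends_lim; apply: tends_posnatP => M; exists M.+1 => n _ nz.
by rewrite -psum_unit_pow lP.
Qed.

Section WithN.
Variables (N : nat) (N_gt1 : (1 < N)%N) (N_p : coprime N p).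

Let pN : ~~ (p %| N)%N.
Proof. by rewrite -prime_coprime // coprime_sym. Qed.
Let nN : `|N%:R : Qp|_p = 1 := padic_norm_nat_unit p_pr pN.
Let NK : N%:R != 0 :> Qp := padic_norm1_neq0 nN.

Definition weighted_sum (g : nat -> Qp) m : Qp :=
  \sum_(0 <= a < p ^ m) (N * a %/ p ^ m)%:R * g a.

Lemma tends_weighted_sum r : tends \oo%classic (weighted_sum (unit_pow p_pr (- r)))
  (- \sum_(1 <= k < N) padic_polygamma (r - 1) (k%:R / N%:R : Qp)).
Proof.
apply: (@tends_oo_shift _ _ _ _ 1); apply/tends_ooP => M; exists M => m Mm.
rewrite opprK addn1; apply: le_trans (expVp_le p_pr Mm).
apply: (psum_weighted (unit_pow_lipschitz p_pr (- r)) N_gt1 N_p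
  (psi := fun k => padic_polygamma (r - 1) (k%:R / N%:R : Qp))) => k m' n.
apply: padic_polygammaP.
by rewrite padic_normM padic_normV nN invr1 mulr1 padic_norm_nat_le1.
Qed.

Lemma natr_mod_expp m a :
  (N * a %% p ^ m)%:R = N%:R * a%:R - p%:R ^+ m * (N * a %/ p ^ m)%:R :> Qp.
Proof.
by rewrite -natrM {2}(divn_eq (N * a) (p ^ m)) natrD natrM natrX mulrC addrC addKr.
Qed.


Section Transform.
Variable i : int.
Local Notation chi := (teichmuller_pow p_pr i).

(* Reindexing by [a |-> N * a %% P], where [N * a %% P = N * a - P * c], and
   expanding modulo [P ^ 2]. *)
Lemma character_sum_transform n m : ((p == 2%N).+1 <= m)%N ->
  `|(1 - chi N * N%:R ^+ n.+1) * \sum_(0 <= a < p ^ m) chi a * a%:R ^+ n.+1 +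
    n.+1%:R * p%:R ^+ m * (chi N * N%:R ^+ n) *
    weighted_sum (fun a => chi a * a%:R ^+ n) m|_p <= p%:R ^- m * p%:R ^- m.
Proof.
move=> em; set P := (p ^ m)%N.
have P0 : (0 < P)%N by rewrite expn_gt0 prime_gt0.
have NP : coprime N P by rewrite coprimeXr.
have qP : (q %| P)%N by rewrite teichmuller_modulusE dvdn_exp2l.
have chi_mod a : chi (N * a %% P)%N = chi N * chi a.
  by rewrite -teichmuller_powM; apply: teichmuller_pow_mod; rewrite modn_dvdm.
pose c a : Qp := (N * a %/ P)%:R.
have -> : (1 - chi N * N%:R ^+ n.+1) * \sum_(0 <= a < P) chi a * a%:R ^+ n.+1 +
    n.+1%:R * p%:R ^+ m * (chi N * N%:R ^+ n) * weighted_sum (fun a => chi a * a%:R ^+ n) m =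
  \sum_(0 <= a < P) chi N * chi a * ((N%:R * a%:R - p%:R ^+ m * c a) ^+ n.+1 -
    (N%:R * a%:R) ^+ n.+1 - n.+1%:R * (N%:R * a%:R) ^+ n * - (p%:R ^+ m * c a)).
  rewrite mulrBl mul1r -{1}(big_modM +%R (fun a => chi a * a%:R ^+ n.+1) P0 NP).
  rewrite mulr_sumr /weighted_sum mulr_sumr -sumrB -big_split /=.
  apply: eq_bigr => a _; rewrite chi_mod natr_mod_expp transform_term //.
apply: padic_norm_le_sum => [|a _]; first by rewrite mulr_ge0 ?expVp_ge0.
have chi1 : `|chi N * chi a|_p <= 1.
  exact: padic_norm_leMl (teichmuller_pow_le1 _ _ _) (teichmuller_pow_le1 _ _ _).
have Na1 : `|N%:R * a%:R : Qp|_p <= 1.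
  exact: padic_norm_leMl (padic_norm_nat_le1 _ _) (padic_norm_nat_le1 _ _).
have Pc : `|- (p%:R ^+ m * c a)|_p <= p%:R ^- m.
  rewrite padic_normN; apply: padic_norm_leMr (padic_norm_nat_le1 _ _).
  by rewrite padic_normX padic_norm_p exprVn.
exact: padic_norm_leMl chi1 (padic_norm_exprD_rem n Na1 Pc (expVp_le1 p_pr m)).
Qed.

End Transform.

Lemma weighted_sum_dist g h m e : 0 <= e -> (forall a, `|g a - h a|_p <= e) ->
  `|weighted_sum g m - weighted_sum h m|_p <= e.
Proof.
move=> e0 gh; rewrite /weighted_sum -sumrB; apply: padic_norm_le_sum => // a _.
rewrite -mulrBr; exact: padic_norm_leMl (padic_norm_nat_le1 _ _) (gh a).
Qed.

Section LValueNear.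
Variables (r : int) (M n : nat).
Hypothesis n_near : `|(n.+1%:Z - (1 - r))%:~R : Qp|_p <= p%:R ^- M.
Local Notation chi := (teichmuller_pow p_pr (1 - r - n.+1%:Z)).
Local Notation Psi := (\sum_(1 <= k < N) padic_polygamma (r - 1) (k%:R / N%:R : Qp)).
Local Notation V := (padic_L_value q (teichmuller_pow p_pr (1 - r)) n.+1).

Lemma L_value_polygamma_near :
  `|(1 - chi N * N%:R ^+ n.+1) * V + chi N * N%:R ^+ n * Psi|_p <= p%:R ^- M.
Proof.
set C := chi N * N%:R ^+ n.+1; set B := chi N * N%:R ^+ n.
have kK := natr_padic_neq0 p_pr (ltn0Sn n); set k : Qp := n.+1%:R in kK *.
have k_gt0 : 0 < `|k|_p by rewrite lt_neqAle padic_norm_ge0 eq_sym padic_norm_eq0 kK.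
have limT := tends_L_value p_pr r (ltn0Sn n).
have limA := tendsD (FF := eventually_filter) (tendsZ (FF := eventually_filter) (1 - C) limT)
  (tendsZ (FF := eventually_filter) (k * B) (tends_weighted_sum r)).
(* The factor |k| must be kept in the bound, as p may divide [n.+1]. The replacement error has k as
   a factor, and the other error tends to 0 with m. *)
have le_k : `|k * ((1 - C) * V + B * Psi)|_p <= `|k|_p * p%:R ^- M.
  rewrite -padic_normN opp_twisted_comb; apply: tends_le limA _.
    by rewrite mulr_gt0 ?expVp_gt0.
  have e0 : 0 < `|k|_p * p%:R ^- M by rewrite mulr_gt0 ?expVp_gt0.
  have [m0 m0P] := expVp_small p_pr e0.
  (* m must make p^(-m) at most |k| p^(-M), and q must divide p^m. *)
  exists (maxn m0 (p == 2%N).+1) => // m /=; rewrite geq_max => /andP[m0m em].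
  have PK := expp_neq0 p_pr m.
  set D := weighted_sum (unit_pow p_pr (- r)) m.
  set D' := weighted_sum (fun a => chi a * a%:R ^+ n) m.
  set T := \sum_(0 <= a < p ^ m) _.
  rewrite (twisted_quotient_split k C B T D D' PK) natrX; apply: padic_norm_leD.
    rewrite (le_trans _ (le_trans (expVp_le p_pr m0m) m0P)) //.
    rewrite padic_normM padic_normV padic_normX padic_norm_p exprVn invrK.
    rewrite -ler_pdivlMr ?exprn_gt0 ?ltr0n ?prime_gt0 //.
    exact: character_sum_transform.
  apply: padic_norm_leM (lexx _) _.
  have B1 : `|B|_p <= 1.
    exact: padic_norm_leMl (teichmuller_pow_le1 _ _ _)
      (padic_norm_leX _ (padic_norm_nat_le1 _ _)).
  apply: padic_norm_leMl B1 _; rewrite padic_norm_distC.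
  apply: weighted_sum_dist => [|a]; first exact: expVp_ge0.
  have near' : `|(n%:Z - - r)%:~R : Qp|_p <= p%:R ^- M.
    by rewrite (_ : n%:Z - - r = n.+1%:Z - (1 - r)) //; lia.
  have := teichmuller_pow_near a near'.
  by rewrite (_ : - r - n%:Z = 1 - r - n.+1%:Z) //; lia.
by move: le_k; rewrite padic_normM ler_pM2l.
Qed.
End LValueNear.

Lemma natr_expz_neq1 (j : int) : j != 0 -> N%:R ^ j != 1 :> Qp.
Proof.
have natX k : (0 < k)%N -> N%:R ^+ k != 1 :> Qp.
  move=> k0; have Nk : (1 < N ^ k)%N by rewrite -(exp1n k) ltn_exp2r.
  by rewrite -natrX -subr_eq0 -[1]/(1%:R) -natrB ?(ltnW Nk) // natr_padic_eq0 subn_eq0 -ltnNge.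
case: j => [[|k]|k] j0; [by rewrite eqxx in j0|by rewrite -exprnP natX|].
by rewrite NegzE -exprnN invr_eq1 natX.
Qed.

(** * The case r <> 1 *)

Section NotOne.
Variable r : int.
Hypothesis r1 : r != 1.
Local Notation Psi := (\sum_(1 <= k < N) padic_polygamma (r - 1) (k%:R / N%:R : Qp)).
Local Notation V := (padic_L_value q (teichmuller_pow p_pr (1 - r))).
Local Notation F := (posnat_near (1 - r%:~R : Qp)).
Let c n : Qp := teichmuller_pow p_pr (1 - r - n%:Z) N * N%:R ^+ n.

Lemma near_1Br M n : `|n%:R - (1 - r%:~R) : Qp|_p <= p%:R ^- M ->
  `|(n%:Z - (1 - r))%:~R : Qp|_p <= p%:R ^- M.
Proof. by rewrite !rmorphB. Qed.

Lemma tends_twist : tends F c (N%:R ^ (1 - r)).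
Proof.
apply: tends_posnatP => M; exists M => n _ /near_1Br/(teichmuller_pow_near N).
by rewrite /unit_pow (negPf pN).
Qed.

Lemma tends_L_num : tends F (fun n => (1 - c n) * V n) (- (N%:R ^ (1 - r) / N%:R * Psi)).
Proof.
apply: (tends_near (g := fun n => - (c n / N%:R * Psi))); last first.
  exact: (tendsN (tendsM (tendsM tends_twist (tends_cst _)) (tends_cst _))).
move=> e e0; have [M Me] := expVp_small p_pr e0; apply/posnat_nearP; exists M.
case=> // n _ /near_1Br/L_value_polygamma_near near.
have cE : c n.+1 / N%:R = teichmuller_pow p_pr (1 - r - n.+1%:Z) N * N%:R ^+ n.
  by rewrite /c exprSr mulrA mulfK.
by rewrite opprK cE; apply: le_trans near Me.
Qed.

Lemma tends_L : tends F V (- (N%:R ^ (1 - r) / N%:R * Psi) / (1 - N%:R ^ (1 - r))).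
Proof.
have c1 : 1 - N%:R ^ (1 - r) != 0 :> Qp.
  by rewrite subr_eq0 eq_sym natr_expz_neq1 // subr_eq0 eq_sym.
have lim1c := tendsB (FF := posnat_near_filter _)
  (tends_cst (FF := posnat_near_filter _) 1) tends_twist.
(* Dividing by 1 - [c n] is legitimate once n is so close to 1 - r that its norm equals that of its
   nonzero limit. *)
apply: (tends_near (g := fun n => (1 - c n) * V n / (1 - c n))).
  move=> e e0; have n1c : 0 < `|1 - N%:R ^ (1 - r) : Qp|_p / 2.
    by rewrite divr_gt0 // lt_neqAle padic_norm_ge0 eq_sym padic_norm_eq0 c1.
  apply: filterS (lim1c _ n1c) => n cn.
  have cn0 : 1 - c n != 0.
    rewrite -padic_norm_eq0 (padic_norm_eq (y := 1 - N%:R ^ (1 - r))) ?padic_norm_eq0 //.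
    lra.
  by rewrite mulrAC divff // mul1r subrr padic_norm0 ltW.
exact: tendsM tends_L_num (tendsV c1 lim1c).
Qed.

Lemma polygamma_sum : Psi = (N%:R - N%:R ^ r) * padic_L q (teichmuller_pow p_pr (1 - r)) r%:~R.
Proof.
have z1 : `|1 - r%:~R : Qp|_p <= 1.
  by rewrite padic_norm_leB ?padic_norm1 ?padic_norm_int_le1.
have zF := posnat_near_proper z1.
rewrite /padic_L (tends_lim tends_L) solve_L_value //.
- by rewrite expfz_neq0.
- by rewrite expfzDr // expr1z invr_expz.
- by rewrite subr_eq0 eq_sym natr_expz_neq1 // subr_eq0 eq_sym.
Qed.

End NotOne.

(** * The case r = 1 *)

Section One.
Local Notation Psi := (\sum_(1 <= k < N) padic_polygamma 0 (k%:R / N%:R : Qp)).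
Let inv_unit := unit_pow p_pr (- 1).
Let D := weighted_sum inv_unit.

(* The same reindexing, for the product of the residues prime to [p]. *)
Lemma units_product m :
  N%:R ^+ (p.-1 * p ^ m) * \prod_(0 <= a < p ^ m.+1)
    (1 - p%:R ^+ m.+1 / N%:R * ((N * a %/ p ^ m.+1)%:R * inv_unit a)) = 1 :> Qp.
Proof.
set P := (p ^ m.+1)%N.
have P0 : (0 < P)%N by rewrite expn_gt0 prime_gt0.
have NP : coprime N P by rewrite coprimeXr.
(* The value 1 at the multiples of p reduces the full product to the units; [w] vanishes there, so
   [hE] needs a factor N only for a prime to p, that is (p-1) p^m times. *)
pose h a : Qp := if (p %| a)%N then 1 else a%:R.
pose w a : Qp := p%:R ^+ m.+1 / N%:R * ((N * a %/ P)%:R * inv_unit a).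
have hE a : h (N * a %% P)%N = N%:R ^+ (coprime a p) * h a * (1 - w a).
  have pP : (p %| P)%N by rewrite dvdn_exp.
  have -> : h (N * a %% P)%N = if (p %| a)%N then 1 else (N * a %% P)%:R.
    by rewrite /h /dvdn modn_dvdm // -/(p %| N * a)%N Euclid_dvdM // (negPf pN).
  rewrite /h /w /inv_unit /unit_pow coprime_sym prime_coprime //.
  case: (boolP (p %| a)%N) => pa /=; first by rewrite expr0 !mulr0 subr0 !mul1r.
  rewrite natr_mod_expp // expr1; apply: unit_factor => //.
  by rewrite natr_padic_neq0 // lt0n; apply: contraNneq pa => ->.
have U0 : \prod_(0 <= a < P) h a != 0.
  elim/big_ind: _ => [|x y x0 y0|a _]; [exact: oner_neq0|exact: mulf_neq0|].
  rewrite /h; case: ifPn => pa; first exact: oner_neq0.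
  by rewrite natr_padic_neq0 // lt0n; apply: contraNneq pa => ->.
apply: (mulIf U0); rewrite mul1r -{2}(big_modM *%R h P0 NP).
under [RHS]eq_bigr do rewrite hE.
rewrite !big_split /= prodrXr mulrAC; congr (_ ^+ _ * _ * _).
rewrite -(totient_pfactor p_pr (ltn0Sn m)) totient_count_coprime -/P.
by apply: eq_bigr => a _; rewrite coprime_sym coprime_pexpr // coprime_sym.
Qed.

Lemma fermat_N : `|N%:R ^+ p.-1 - 1 : Qp|_p <= p%:R^-1.
Proof.
rewrite -natrX -[1]/(1%:R) -[p%:R in X in _ <= X]expr1 padic_norm_natB_le expn1.
by have /eqP := Euler_exp_totient N_p; rewrite totient_prime.
Qed.

(** The product of units is taken modulo p^m.+1, but its inverse Y^(p^m) has exponent p^m and the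
    division is by p^m: hence the factor p in the limit, and p^(-1) in the final formula. *)
Lemma tends_quotient_log :
  tends \oo%classic (fun m => ((N%:R ^+ p.-1) ^+ (p ^ m) - 1) / (p ^ m)%:R)
    (- (p%:R / N%:R * Psi)).
Proof.
set Y : Qp := N%:R ^+ p.-1.
have limY : tends \oo%classic (fun m => Y ^+ (p ^ m)) 1.
  apply/tends_ooP => M; exists M => m Mm.
  by rewrite (le_trans (padic_norm_exp_p m fermat_N)) // expVp_le // leqW.
have limD := tends_weighted_sum 1; rewrite subrr in limD.
have limD1 := tends_oo_subseq 1 limD.
have lim := tendsM (FF := eventually_filter) limY
  (tendsZ (FF := eventually_filter) (p%:R / N%:R) limD1).
rewrite mul1r mulrN in lim; apply: tends_near lim => e e0.
have [M Me] := expVp_small p_pr e0; exists M => // m /= Mm.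
apply: le_trans Me; rewrite addn1.
have unitsE := units_product m; rewrite exprM -/Y in unitsE.
have PK := expp_neq0 p_pr m.
rewrite (quotient_remainder _ _ _ PK unitsE) padic_normN padic_normM.
have nY : `|Y ^+ (p ^ m)|_p <= 1 by do 2 apply: padic_norm_leX; exact: padic_norm_nat_le1.
have rem : `|\prod_(0 <= a < p ^ m.+1)
    (1 - p%:R ^+ m.+1 / N%:R * ((N * a %/ p ^ m.+1)%:R * inv_unit a)) - 1 +
    p%:R * (p ^ m)%:R / N%:R * D m.+1|_p <= p%:R ^- m.+1 * p%:R ^- m.+1.
  rewrite natrX -exprS /D /weighted_sum mulr_sumr; apply: padic_norm_prod1B_rem; last first.
    by rewrite expVp_ge0 expVp_le1.
  move=> a; apply: padic_norm_leMr; last first.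
    exact: padic_norm_leMl (padic_norm_nat_le1 _ _) ((unit_pow_lipschitz _ _).1 a).
  by rewrite padic_normM padic_normV nN invr1 mulr1 padic_normX padic_norm_p exprVn.
have nP : `|(p ^ m)%:R^-1 : Qp|_p = p%:R ^+ m.
  by rewrite padic_normV natrX padic_normX padic_norm_p exprVn invrK.
rewrite nP -ler_pdivlMr ?exprn_gt0 ?ltr0n ?prime_gt0 //.
apply: le_trans (padic_norm_leMl nY rem) _.
by rewrite ler_pM ?expVp_ge0 ?expVp_le // leqW.
Qed.

Lemma polygamma_sum0 : Psi = - (N%:R * p%:R^-1 * padic_log (N%:R ^+ p.-1)).
Proof.
rewrite (padic_logE fermat_N tends_quotient_log).
have pK : p%:R != 0 :> Qp by rewrite natr_padic_neq0 // prime_gt0.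
rewrite mulrN opprK; exact: polygamma_cancel NK pK.
Qed.

End One.

End WithN.
End PolygammaSum.

Theorem theorem2p4 (p N : nat) (p_pr : prime p) (hN : (1 < N)%N)
    (hNp : coprime N p) :
  (forall r : int, r != 1 ->
     \sum_(1 <= k < N) padic_polygamma (r - 1) (k%:R / N%:R : padic p_pr) =
     (N%:R - N%:R ^ r) *
       padic_L (teichmuller_modulus p) (teichmuller_pow p_pr (1 - r)) r%:~R) /\
  \sum_(1 <= k < N) padic_polygamma 0 (k%:R / N%:R : padic p_pr) =
  - (N%:R * p%:R^-1 * padic_log (N%:R ^+ p.-1)).
Proof.
by split=> [r r1|]; [exact: polygamma_sum|exact: polygamma_sum0].
Qed.
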